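(* Let $T>0$, $1<\alpha,\beta\le2$, $0\le\mu\le1$, $\lambda\in\mathbb{C}$, $\xi_0,\xi_1\in\mathbb{R}$, and put $\gamma=\beta+\mu(2-\beta)$, $\delta=\beta+\mu(\alpha-\beta)$. Let $g\in C[-T,0]$ with $g'\in L_1(-T,0)$. Then the solution $u$ of the Cauchy problem $$D_{0-}^{(\alpha,\beta)\mu}u(t)=\lambda u(t)+g(t),\qquad \lim_{t\to0-}I_{0-}^{2-\gamma}u(t)=\xi_0,\qquad \lim_{t\to0-}\frac{d}{dt}I_{0-}^{2-\gamma}u(t)=\xi_1,$$ for $t\in(-T,0)$, is $$u(t)=\xi_0(-t)^{\gamma-2}E_{\delta,\gamma-1}\left[\lambda(-t)^{\delta}\right]-\xi_1(-t)^{\gamma-1}E_{\delta,\gamma}\left[\lambda(-t)^{\delta}\right]+\int_t^0(z-t)^{\delta-1}E_{\delta,\delta}\left[\lambda(z-t)^{\delta}\right]g(z)\,dz.$$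
   Context: For $\alpha>0$ the right-sided Riemann-Liouville fractional integral with base point $0$ is $$I_{0-}^{\alpha}g(t)=\frac{1}{\Gamma(\alpha)}\int_t^0\frac{g(z)\,dz}{(z-t)^{1-\alpha}},\qquad t<0,$$ and $I_{0-}^0$ is the identity. For $1<\alpha,\beta\le2$ and $0\le\mu\le1$, the right-sided bi-ordinal Hilfer fractional derivative of orders $\alpha,\beta$ and type $\mu$ is $$D_{0-}^{(\alpha,\beta)\mu}g(t)=I_{0-}^{\mu(2-\alpha)}\left(-\frac{d}{dt}\right)^2I_{0-}^{(1-\mu)(2-\beta)}g(t),$$ where $(1-\mu)(2-\beta)=2-\gamma$ with $\gamma=\beta+\mu(2-\beta)$. The two-parameter Mittag-Leffler function is $E_{\alpha,\beta}(z)=\sum_{k=0}^{\infty}\frac{z^k}{\Gamma(\alpha k+\beta)}$ for $\alpha>0$, $\beta\in\mathbb{R}$. *)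

(* Defs.v *)
From mathcomp Require Import all_boot all_order all_algebra.
From mathcomp Require Import complex.
From mathcomp Require Import all_classical all_reals all_analysis.

Set Implicit Arguments.
Unset Strict Implicit.
Unset Printing Implicit Defensive.

Import Order.TTheory GRing.Theory Num.Theory.
Import numFieldNormedType.Exports.

Local Open Scope classical_set_scope.
Local Open Scope complex_scope.
Local Open Scope ring_scope.

Section BiOrdinalHilfer.
Variable R : realType.
Implicit Types (f g h u : R -> R[i]) (a b t x y : R) (z : R[i]).

(* Measure, integral and derivative of the library are real-valued; functions
   of a real variable with values in C are treated through their real and
   imaginary parts. The topology of C is the one of R[i]^o. *)

Definition cintegrable (A : set R) f : Prop :=
  (@lebesgue_measure R).-integrable A (fun x => (complex.Re (f x))%:E) /\
  (@lebesgue_measure R).-integrable A (fun x => (complex.Im (f x))%:E).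

Definition cintegral (A : set R) f : R[i] :=
  (\int[@lebesgue_measure R]_(x in A) complex.Re (f x)) +i*
  (\int[@lebesgue_measure R]_(x in A) complex.Im (f x)).

Definition cderivable f t : Prop :=
  derivable (fun x => complex.Re (f x)) t 1 /\
  derivable (fun x => complex.Im (f x)) t 1.

Definition cderive f t : R[i] :=
  derive1 (fun x => complex.Re (f x)) t +i*
  derive1 (fun x => complex.Im (f x)) t.

(* h is the derivative, in L_1(a, b), of f. The increments of f must be the
   integrals of h: an almost everywhere derivative is not enough (for the
   Cantor function it vanishes, and lies in L_1). *)
Definition L1_derivative a b f h : Prop :=
  cintegrable `]a, b[ h /\
  forall x y, a < x -> x <= y -> y < b -> f y - f x = cintegral `[x, y] h.

(* Euler's integral, which converges for x > 0. *)
Definition Gamma_integral x : R :=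
  \int[@lebesgue_measure R]_(s in `]0, +oo[) (s `^ (x - 1) * expR (- s)).

(* For x <= 0, Gamma(x + n) / (x (x + 1) ... (x + n - 1)) with n large enough
   that x + n > 0. At a pole one factor is 0 and, since 0^-1 = 0, the value is
   0, so that 1 / Gamma is 0 there, as is usual. *)
Definition Gamma x : R :=
  let n := if 0 < x then 0%N else (Num.truncn (- x)).+1 in
  Gamma_integral (x + n%:R) / \prod_(i < n) (x + i%:R).

Definition mittag_leffler a b z : R[i] :=
  limn (series (fun k => z ^+ k / (Gamma (a * k%:R + b))%:C : R[i]^o)).

Definition RL_kernel a t f x : R[i] := ((x - t) `^ (a - 1))%:C * f x.

Definition RL_integral a f t : R[i] :=
  if a == 0 then f t
  else ((Gamma a)^-1)%:C * cintegral `]t, 0[ (RL_kernel a t f).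

Definition RL_convergent a f t : Prop :=
  a != 0 -> cintegrable `]t, 0[ (RL_kernel a t f).

Definition bihilfer alpha beta mu f : R -> R[i] :=
  RL_integral (mu * (2 - alpha))
    (iter 2 (fun h t => - cderive h t)
       (RL_integral ((1 - mu) * (2 - beta)) f)).

(* The functions of C(-T, 0) and L_1(-T, 0) to which bihilfer applies:
   w, the inner integral, is differentiable on (-T, 0), its derivative w' has a
   derivative v in L_1(-T, 0), and the outer integral of v converges at every
   point. Almost everywhere, w' is differentiable with derivative v, but in
   general it is not so everywhere when the order of the outer integral is
   positive. The inner integral of a function of this class always converges. *)
Definition bihilfer_domain T alpha beta mu u : Prop :=
  let w := RL_integral ((1 - mu) * (2 - beta)) u in
  [/\ {in `]- T, 0[, continuous (u : R -> R[i]^o)},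
      cintegrable `]- T, 0[ u,
      {in `]- T, 0[, forall t, cderivable w t} &
      exists2 v : R -> R[i],
        L1_derivative (- T) 0 (cderive w) v &
        {in `]- T, 0[, forall t, RL_convergent (mu * (2 - alpha)) v t}].

Definition cauchy_solution T alpha beta mu (lambda : R[i]) (xi0 xi1 : R) g u
    : Prop :=
  let gamma := beta + mu * (2 - beta) in
  [/\ bihilfer_domain T alpha beta mu u,
      {in `]- T, 0[, forall t, bihilfer alpha beta mu u t = lambda * u t + g t},
      (RL_integral (2 - gamma) u t : R[i]^o) @[t --> 0^'-] -->
        (xi0%:C : R[i]^o) &
      (cderive (RL_integral (2 - gamma) u) t : R[i]^o) @[t --> 0^'-] -->
        (xi1%:C : R[i]^o)].

End BiOrdinalHilfer.

(* Main.v *)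
Require Import Defs.
From mathcomp Require Import all_boot all_order all_algebra.
From mathcomp Require Import complex.
From mathcomp Require Import all_classical all_reals all_analysis.
From mathcomp Require Import measurable_realfun ring lra.

(* Write I^a for the fractional integral of order a with base point 0, and
   k_a(x) = x^(a-1) / Gamma(a) for x > 0, so that I^a f(t) is the integral of
   k_a(x - t) f(x) over x in ]t, 0[. Euler's Beta integral says that
   k_a * k_b = k_(a+b), and by Fubini's theorem I^a I^b f(t) = I^(a+b) f(t) at
   every t where the right-hand side converges absolutely.

   Put nu = mu (2 - alpha), so that gamma = delta + nu, and h = lambda u + g.
   Two integrations of the derivative v = w'' of w = I^(2-gamma) u give
   w(t) = xi0 + xi1 t + I^2 v(t). Applying I^(gamma-1) and using I^nu v = h, this
   becomes I^1 u = I^1 (...), and differentiation yields the Volterra equation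
     u(t) = xi0 k_(gamma-1)(-t) - xi1 k_gamma(-t) + I^delta (lambda u + g)(t).
   Conversely, a solution of the Volterra equation solves the Cauchy problem
   because h can be written as I^nu v with v in L_1: this is where g' in L_1 is
   used, through g = g(0) - I^nu I^(1-nu) g'.

   The Volterra equation is solved by iteration. Since I^delta maps k_b(-t) to
   k_(delta+b)(-t), this leads to the sums over k of lambda^k k_(delta k + b)(x),
   which are x^(b-1) E_(delta,b)(lambda x^delta); they converge because
   Gamma(x) >= N^(x-1) e^(-N-1) for every N > 0 and x >= 1. *)

Set Implicit Arguments.
Unset Strict Implicit.
Unset Printing Implicit Defensive.

Import Order.TTheory GRing.Theory Num.Theory.
Import numFieldNormedType.Exports.

Local Open Scope classical_set_scope.
Local Open Scope ring_scope.

(** * The Gamma and Beta integrals *)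

(** Two obstacles shape the argument. The first is convergence. For a >= 1 the kernel k_a is bounded
    on bounded intervals, so I^a f converges at every point for integrable f; for a < 1 it may
    diverge at some points. Identities are therefore raised to total order at least 1: u and the
    right-hand side F of its Volterra equation are compared through I^1, which is injective on
    continuous functions, and convergence of I^nu v, with nu < 1, is read off the semigroup law. The
    second is that v is the derivative of w' only almost everywhere. An outer integral of positive
    order ignores null sets, but for nu = 0 the equation holds point by point; there v = h can be
    chosen, which is continuous, so that w'' = v everywhere. Hence the case distinctions on nu = 0.
    Those on gamma = 2 arise because [RL_integral] is the identity at order 0, while an integral
    against k_0 is not. Near 0 the solution may grow like (-t)^(gamma-2), so u is only integrable
    there, and every domination of the series keeps a term k_(gamma-1)(-t) next to the constants. *)

Section translation_scaling.
Variable R : realType.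
Notation mu := (@lebesgue_measure R).

(** The image of the Lebesgue measure under a translation gives every interval []a, b]] its length,
    so uniqueness of the Lebesgue measure identifies the two. *)
Lemma ge0_integral_shift (f : R -> \bar R) (c : R) :
  measurable_fun [set: R] f -> (forall x, 0 <= f x)%E ->
  (\int[mu]_x f (x + c)%R = \int[mu]_x f x)%E.
Proof.
move=> mf f0.
have mphi : measurable_fun setT (fun x : measurableTypeR R => (x + c)%R : measurableTypeR R).
  exact: measurable_funD.
transitivity (\int[pushforward mu
    (fun x : measurableTypeR R => (x + c)%R : measurableTypeR R)]_y f y)%E.
  by rewrite ge0_integral_pushforward.
apply: eq_measure_integral => //= A mA _; apply/esym.
apply: (@lebesgue_measure_unique R (pushforward mu _)) => //.
move=> _ [[a b]] _ <-.
transitivity (mu `](a - c), (b - c)]%classic); last first.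
  rewrite -[RHS]/(mu _); congr (mu _).
  by apply/seteqP; split => x /=; rewrite !in_itv/= ltrBlDr lerBrDr.
rewrite !lebesgue_measure_itv/= !lte_fin ltrD2r; case: ifPn => // _.
by rewrite -!EFinB; congr EFin; ring.
Qed.

(** The map x -> c x pushes the Lebesgue measure to one that divides lengths by c; the factor
    [mscale cn] restores them, and uniqueness applies again. *)
Lemma ge0_integral_scale (f : R -> \bar R) (c : R) :
  0 < c -> measurable_fun [set: R] f -> (forall x, 0 <= f x)%E ->
  (c%:E * \int[mu]_x f (c * x)%R = \int[mu]_x f x)%E.
Proof.
move=> c0 mf f0.
pose phi := (fun x : measurableTypeR R => (c * x)%R : measurableTypeR R).
have mphi : measurable_fun setT phi by exact: measurable_funM.
pose cn := NngNum (ltW c0).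
transitivity (\int[pushforward (mscale cn mu) phi]_y f y)%E.
  rewrite ge0_integral_pushforward//.
  rewrite preimage_setT ge0_integral_mscale//.
  exact: (measurableT_comp mf mphi).
  by move=> x _; exact: f0.
apply: eq_measure_integral => //= A mA _; apply/esym.
apply: (@lebesgue_measure_unique R (pushforward (mscale cn mu) phi)) => //.
move=> _ [[a b]] _ <-.
transitivity (c%:E * mu `](c^-1 * a)%R, (c^-1 * b)%R]%classic)%E; last first.
  rewrite -[RHS]/(c%:E * mu _)%E; congr (_ * mu _)%E.
  apply/seteqP; split => x /=; rewrite !in_itv/= /phi.
    by move=> /andP[ax xb]; rewrite -ltr_pdivrMl// ax -ler_pdivlMl.
  by move=> /andP[ax xb]; rewrite ltr_pdivrMl// ax ler_pdivlMl.
rewrite !lebesgue_measure_itv/= !lte_fin ltr_pM2l ?invr_gt0//.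
case: ifPn => // _; last by rewrite mule0.
rewrite -!EFinB -EFinM; congr EFin; field; exact: lt0r_neq0.
Qed.

End translation_scaling.

Section gamma_beta.
Variable R : realType.
Notation mu := (@lebesgue_measure R).

Implicit Types a b : R.

(* The factor that vanishes for x <= 0 turns integrals over intervals into
   integrals over the line: powR is 1 at negative numbers. *)
Definition pospow (a x : R) : R := if 0 < x then x `^ (a - 1) else 0.

Lemma pospow_ge0 a x : 0 <= pospow a x.
Proof. by rewrite /pospow; case: ifPn => // _; exact: powR_ge0. Qed.

Lemma pospow_le0 a x : x <= 0 -> pospow a x = 0.
Proof. by rewrite /pospow leNgt => /negbTE ->. Qed.

Lemma pospow_gt0 a x : 0 < x -> pospow a x = x `^ (a - 1).
Proof. by rewrite /pospow => ->. Qed.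

Lemma measurable_pospow a : measurable_fun [set: R] (pospow a).
Proof.
apply: measurable_fun_ifT => //; first exact: measurable_fun_ltr.
Qed.

Lemma pospowM a s x : 0 < s -> pospow a (s * x) = s `^ (a - 1) * pospow a x.
Proof.
move=> s0; rewrite /pospow pmulr_rgt0//; case: ifPn => x0; last by rewrite mulr0.
by rewrite powRM// ltW.
Qed.

(** Extended real values allow Tonelli's theorem to be applied before any convergence is known.
    [ebeta a b s] is the convolution at s of two truncated powers; at s = 1 it is Euler's Beta
    integral. *)
Definition egamma a : \bar R := (\int[mu]_x (pospow a x * expR (- x))%:E)%E.
Definition ebeta a b s : \bar R := (\int[mu]_x (pospow a x * pospow b (s - x))%:E)%E.

Lemma egamma_ge0 a : (0 <= egamma a)%E.
Proof. by apply: integral_ge0 => x _; rewrite lee_fin mulr_ge0 ?pospow_ge0 ?expR_ge0. Qed.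

Lemma ebeta_ge0 a b s : (0 <= ebeta a b s)%E.
Proof. by apply: integral_ge0 => x _; rewrite lee_fin mulr_ge0 ?pospow_ge0. Qed.

Lemma measurable_pospow_expR a : measurable_fun [set: R] (fun x => pospow a x * expR (- x)).
Proof.
apply: measurable_funM; first exact: measurable_pospow.
by apply: measurableT_comp => //; exact: measurable_oppr.
Qed.

Lemma emeasurable_pospow_expR a :
  measurable_fun [set: R] (fun x => (pospow a x * expR (- x))%:E).
Proof. by apply/measurable_EFinP; exact: measurable_pospow_expR. Qed.

Lemma measurable_pospow_shift b s : measurable_fun [set: R] (fun x => pospow b (s - x)).
Proof. by apply: (measurableT_comp (measurable_pospow b)); exact: measurable_funB. Qed.

(** For s > 0, substitute s x for x: the integrand is homogeneous. For s <= 0 the supports of the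
    two factors do not meet. *)
Lemma ebetaZ a b s : ebeta a b s = ((pospow (a + b) s)%:E * ebeta a b 1)%E.
Proof.
have [s0|s0] := ltP 0 s; last first.
  rewrite pospow_le0// mul0e /ebeta integral0_eq// => x _; congr EFin.
  have [x0|x0] := leP x 0; first by rewrite pospow_le0 ?mul0r.
  by rewrite [X in _ * X]pospow_le0 ?mulr0// subr_le0 (le_trans s0)// ltW.
rewrite /ebeta -(ge0_integral_scale s0); last 2 first.
  apply/measurable_EFinP; apply: measurable_funM; first exact: measurable_pospow.
  exact: measurable_pospow_shift.
  by move=> x; rewrite lee_fin mulr_ge0 ?pospow_ge0.
under eq_integral => x _.
  rewrite pospowM// (_ : s - s * x = s * (1 - x)); last by ring.
  rewrite pospowM// mulrACA EFinM.
  over.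
rewrite ge0_integralZl//; last 3 first.
  apply/measurable_EFinP; apply: measurable_funM; first exact: measurable_pospow.
  exact: measurable_pospow_shift.
  by move=> x _; rewrite lee_fin mulr_ge0 ?pospow_ge0.
  by rewrite lee_fin mulr_ge0 ?powR_ge0.
rewrite muleA -EFinM; congr (_%:E * _)%E.
rewrite -powRD ?(gt_eqF s0) ?implybT//.
rewrite -[X in X * _]powRr1 ?ltW// -powRD ?(gt_eqF s0) ?implybT//.
by rewrite pospow_gt0//; congr (_ `^ _); ring.
Qed.

(* Substitute y = s - x in the second factor and integrate over x first. *)
Lemma egammaM a b : (egamma a * egamma b = ebeta a b 1 * egamma (a + b))%E.
Proof.
pose F (z : R * R) := (pospow a z.1 * pospow b (z.2 - z.1) * expR (- z.2))%:E.
have mF : measurable_fun [set: R * R] F.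
  apply/measurable_EFinP; apply: measurable_funM; last first.
    apply: measurableT_comp => //; exact: measurableT_comp.
  apply: measurable_funM; first exact: (measurableT_comp (measurable_pospow a)).
  by apply: (measurableT_comp (measurable_pospow b)); exact: measurable_funB.
have F0 z : (0 <= F z)%E.
  by rewrite lee_fin !mulr_ge0 ?pospow_ge0 ?expR_ge0.
rewrite {1}/egamma -ge0_integralZr ?egamma_ge0//; last 2 first.
  exact: emeasurable_pospow_expR.
  by move=> x _; rewrite lee_fin mulr_ge0 ?pospow_ge0 ?expR_ge0.
transitivity (\int[mu]_x \int[mu]_s (pospow a x * pospow b (s - x) * expR (- s))%:E)%E.
  apply: eq_integral => x _.
  rewrite /egamma -(ge0_integral_shift (- x)); last 2 first.
    exact: emeasurable_pospow_expR.
    by move=> y; rewrite lee_fin mulr_ge0 ?pospow_ge0 ?expR_ge0.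
  rewrite -ge0_integralZl; last 4 first.
    by [].
    apply: (measurableT_comp (emeasurable_pospow_expR b)).
    exact: measurable_funB.
    by move=> y _; rewrite lee_fin mulr_ge0 ?pospow_ge0 ?expR_ge0.
    by rewrite lee_fin mulr_ge0 ?pospow_ge0 ?expR_ge0.
  apply: eq_integral => s _; rewrite -EFinM; congr EFin.
  rewrite (_ : - (s - x) = - s + x) ?expRD ?expRN; last by ring.
  by field; rewrite gt_eqF//= ?expR_gt0// gt_eqF// expR_gt0.
transitivity (\int[mu]_s \int[mu]_x F (x, s))%E.
  have H := @fubini_tonelli _ _ _ _ R mu mu F mF F0.
  exact: etrans H _.
transitivity (\int[mu]_s (ebeta a b 1 * (pospow (a + b) s * expR (- s))%:E))%E; last first.
  rewrite ge0_integralZl ?ebeta_ge0//.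
    exact: emeasurable_pospow_expR.
  by move=> x _; rewrite lee_fin mulr_ge0 ?pospow_ge0 ?expR_ge0.
apply: eq_integral => s _; rewrite EFinM muleA [X in (X * _)%E]muleC -ebetaZ.
rewrite /ebeta -ge0_integralZr; last 4 first.
  by [].
  apply/measurable_EFinP; apply: measurable_funM; first exact: measurable_pospow.
  exact: measurable_pospow_shift.
  by move=> x _; rewrite lee_fin mulr_ge0 ?pospow_ge0.
  by rewrite lee_fin expR_ge0.
by apply: eq_integral.
Qed.


Lemma egammaE a :
  (egamma a = \int[mu]_(x in `]0%R, +oo[) (x `^ (a - 1) * expR (- x))%:E)%E.
Proof.
rewrite [RHS]integral_mkcond; apply: eq_integral => x _.
rewrite patchE mem_setE in_itv/= andbT /pospow; case: ifPn => // _.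
by rewrite mul0r.
Qed.

Lemma egamma1 : egamma 1 = 1%E.
Proof.
rewrite egammaE.
under eq_integral => x _ do rewrite subrr powRr0 mul1r.
rewrite -(@integral_exponential_pdf R 1)//.
rewrite integral_itv_obnd_cbnd//; last first.
  apply/measurable_EFinP/measurable_funTS/measurableT_comp => //.
rewrite integral_mkcond; apply: eq_integral => x _ /=.
rewrite /exponential_pdf !patchE; case: ifPn => // _.
by rewrite /= mul1r mulN1r.
Qed.

Lemma is_derive_powR_onem (b x : R) : b != 0 -> x < 1 ->
  is_derive x 1 (fun y => - ((1 - y) `^ b / b)) ((1 - x) `^ (b - 1)).
Proof.
move=> b0 x1.
have x1' : 0 < 1 - x by rewrite subr_gt0.
have dp := is_derive1_powR b x1'.
have d1 : is_derive x 1 (fun y : R => 1 - y) (-1).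
  by apply: is_derive_eq; rewrite add0r mul1r.
have dc : is_derive x 1 ((@powR R ^~ b) \o (fun y => 1 - y)) (b * (1 - x) `^ (b - 1) * -1).
  exact: is_derive1_comp.
rewrite (_ : (fun y => _) = (- b^-1) \*: ((@powR R ^~ b) \o (fun y => 1 - y))); last first.
  by apply/funext => y /=; rewrite /GRing.scale/= mulNr mulrC.
apply: is_derive_eq.
by rewrite /GRing.scale/=; field.
Qed.

(** The integrand (1 - x)^(b-1) may be singular at 1, so the fundamental theorem is applied on
    [0, 1 - 1/(n+1)], and monotone convergence reaches [0, 1[. *)
Lemma ebeta1 b : 0 < b -> ebeta 1 b 1 = (b^-1)%:E.
Proof.
move=> b0; have bn0 : b != 0 by rewrite gt_eqF.
pose F (n : nat) : set R := `[0, 1 - n.+1%:R^-1]%classic.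
pose f x : \bar R := ((1 - x) `^ (b - 1))%:E.
have mf : measurable_fun [set: R] f.
  apply/measurable_EFinP/(measurableT_comp (measurable_powR (b - 1))).
  exact: measurable_funB.
have FU : \bigcup_n F n = `[0, 1[%classic.
  apply/seteqP; split=> [x [n _]|x]; rewrite /F /= !in_itv/=.
    move=> /andP[-> /le_lt_trans]; apply.
    by rewrite ltrBlDr ltrDl invr_gt0.
  move=> /andP[x0 x1]; exists (Num.truncn (1 - x)^-1) => //=.
  rewrite in_itv/= x0/= lerBrDr -lerBrDl invf_ple ?posrE ?subr_gt0//.
  by rewrite ltW// truncnS_gt.
have E n : (\int[mu]_(x in F n) f x = (b^-1 - n.+1%:R^-1 `^ b / b)%:E)%E.
  (* For n = 0 the interval is the single point 0, and the fundamental theorem does not apply. *)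
  have [->|n0] := eqVneq n 0%N.
    by rewrite /F invr1 subrr set_itv1 integral_set1 powR1 mul1r subrr.
  have lt1 : 0 < 1 - n.+1%:R^-1 :> R.
    by rewrite subr_gt0 invf_lt1// ltr1n ltnS lt0n.
  have cf : {in `[0, 1 - n.+1%:R^-1], continuous (fun x : R => (1 - x) `^ (b - 1))}.
    move=> x; rewrite in_itv/= => /andP[_ x1].
    have x1' : 0 < 1 - x.
      by rewrite subr_gt0 (le_lt_trans x1)// ltrBlDr ltrDl invr_gt0.
    apply: differentiable_continuous; apply/derivable1_diffP.
    have dp := is_derive1_powR (b - 1) x1'.
    have d1 : is_derive x 1 (fun y : R => 1 - y) (-1).
      by apply: is_derive_eq; rewrite add0r mul1r.
    have dc : is_derive x 1 ((@powR R ^~ (b - 1)) \o (fun y => 1 - y))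
        ((b - 1) * (1 - x) `^ (b - 1 - 1) * -1).
      exact: is_derive1_comp.
    exact: ex_derive.
  have dF (x : R) : x <= 1 - n.+1%:R^-1 ->
      is_derive x 1 (fun y : R => - ((1 - y) `^ b / b)) ((1 - x) `^ (b - 1)).
    move=> x1; apply: is_derive_powR_onem => //.
    by rewrite (le_lt_trans x1)// ltrBlDr ltrDl invr_gt0.
  have cG (x : R) : x <= 1 - n.+1%:R^-1 ->
      {for x, continuous (fun y : R => - ((1 - y) `^ b / b))}.
    move=> /dF dx; apply: differentiable_continuous; apply/derivable1_diffP.
    exact: ex_derive.
  rewrite (@continuous_FTC2 _ _ (fun y => - ((1 - y) `^ b / b)))//.
  - rewrite -EFinB; congr EFin; rewrite subr0 powR1 mul1r opprK.
    by rewrite (_ : 1 - (1 - n.+1%:R^-1) = n.+1%:R^-1) 1?addrC//; ring.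
  - by apply: continuous_in_subspaceT => x; rewrite inE/=; exact: cf.
  - split.
    + by move=> x /[!in_itv]/= /andP[_ /ltW /dF ?]; exact: ex_derive.
    + by apply: cvg_at_right_filter; exact: (cG 0 (ltW lt1)).
    + by apply: cvg_at_left_filter; exact: (cG _ (lexx _)).
  - move=> x /[!in_itv]/= /andP[_ /ltW /dF ?].
    by rewrite derive1E derive_val.
have cv1 : (\int[mu]_(x in F n) f x)%E @[n --> \oo] --> (\int[mu]_(x in `[0%R, 1%R[) f x)%E.
  rewrite -FU; apply: ge0_nondecreasing_set_cvg_integral.
  - apply/nondecreasing_seqP => n; rewrite subsetEset; apply: subset_itvl.
    by rewrite bnd_simp lerB// lef_pV2 ?posrE// ler_nat.
  - by move=> i; exact: measurable_itv.
  - by move=> i; exact: measurable_funTS.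
  - by move=> i x _; rewrite lee_fin powR_ge0.
have cv2 : (\int[mu]_(x in F n) f x)%E @[n --> \oo] --> (b^-1)%:E.
  rewrite (_ : (fun n => _) = (fun n => (b^-1 - n.+1%:R^-1 `^ b / b)%:E)); last exact/funext.
  apply: cvg_EFin; first exact: nearW.
  rewrite -[X in _ --> X](subr0 (b^-1)); apply: cvgB; first exact: cvg_cst.
  rewrite -[X in _ --> X](mul0r (b^-1)); apply: cvgMl.
  have := @powR_cvg0 R _ b0; move/cvg_at_rightP; apply.
  split=> [n|]; first by rewrite invr_gt0.
  exact: cvg_harmonic.
rewrite -(cvg_unique _ cv1 cv2)//.
rewrite -integral_itv_obnd_cbnd; last exact: measurable_funTS.
rewrite [RHS]integral_mkcond/=; apply: eq_integral => x _.
rewrite patchE mem_setE in_itv/= /pospow subrr powRr0 subr_gt0 /f.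
by case: (0 < x) => /=; case: (x < 1) => //=; rewrite ?mul1r ?mul0r ?mulr0.
Qed.

(** The functional equation is the Beta identity [egammaM] with first argument 1, in place of an
    integration by parts. *)
Lemma egammaS b : 0 < b -> (egamma (1 + b) = b%:E * egamma b)%E.
Proof.
move=> b0; have := egammaM 1 b; rewrite egamma1 mul1e ebeta1// => ->.
by rewrite muleA -EFinM divff ?mul1e// gt_eqF.
Qed.

Lemma pospow_le_nat a n x : 1 <= a -> a <= n.+1%:R -> pospow a x <= pospow 1 x + pospow n.+1%:R x.
Proof.
move=> a1 an; rewrite /pospow; case: ifPn => x0; last by rewrite addr0.
rewrite subrr powRr0; have [x1|x1] := leP 1 x.
  by rewrite (@le_trans _ _ (x `^ (n.+1%:R - 1)))// ?lerDr// ler_powR// lerB.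
rewrite ler_wpDr ?powR_ge0// (@le_trans _ _ (x `^ 0)) ?powRr0//.
by rewrite -[leRHS](powRr0 x) ger_powR// ?subr_ge0// x0 ltW.
Qed.

(** Integers follow from the functional equation, and any a >= 1 by comparison with 1 and an integer
    above a. For 0 < a < 1 the functional equation is read backwards: a times the integral is
    finite, hence so is the integral. *)
Lemma egamma_lty a : 0 < a -> (egamma a < +oo)%E.
Proof.
have N n : (egamma n.+1%:R < +oo)%E.
  elim: n => [|n IH]; first by rewrite egamma1 ltry.
  by rewrite -natr1 addrC egammaS// lte_mul_pinfty.
have G1 b : 1 <= b -> (egamma b < +oo)%E.
  move=> b1; pose n := Num.truncn b.
  apply: (@le_lt_trans _ _ (egamma 1 + egamma n.+1%:R)%E); last first.
    by rewrite lte_add_pinfty// egamma1 ltry.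
  rewrite /egamma -ge0_integralD//; last 4 first.
  - by move=> x _; rewrite lee_fin mulr_ge0 ?pospow_ge0 ?expR_ge0.
  - exact: emeasurable_pospow_expR.
  - by move=> x _; rewrite lee_fin mulr_ge0 ?pospow_ge0 ?expR_ge0.
  - exact: emeasurable_pospow_expR.
  apply: ge0_le_integral => //.
  - by move=> x _; rewrite lee_fin mulr_ge0 ?pospow_ge0 ?expR_ge0.
  - exact: emeasurable_pospow_expR.
  - by apply: emeasurable_funD; exact: emeasurable_pospow_expR.
  - move=> x _; rewrite -EFinD lee_fin -mulrDl ler_wpM2r ?expR_ge0//.
    by rewrite pospow_le_nat// ltW// truncnS_gt.
move=> a0; have : (egamma (1 + a) < +oo)%E by rewrite G1// lerDl ltW.
rewrite egammaS//; have := egamma_ge0 a.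
by case: (egamma a) => [r| |]//= _; rewrite ?ltry// gt0_muley.
Qed.

(* Restrict Euler's integral to [N, N + 1]. *)
Lemma egamma_ge a N : 1 <= a -> 0 < N ->
  ((N `^ (a - 1) * expR (- (N + 1)))%:E <= egamma a)%E.
Proof.
move=> a1 N0; rewrite egammaE.
apply: (@le_trans _ _ (\int[mu]_(x in `[N, (N + 1)%R])
  (cst (N `^ (a - 1) * expR (- (N + 1)))%:E x))%E).
  rewrite integral_cst//= lebesgue_measure_itv/= lte_fin ltrDl ltr01 -EFinB.
  by rewrite (addrC N) addrK mule1.
apply: (@le_trans _ _ (\int[mu]_(x in `[N, (N + 1)%R]) (x `^ (a - 1) * expR (- x))%:E)%E).
  apply: ge0_le_integral => //.
  - by move=> x _; rewrite lee_fin mulr_ge0 ?powR_ge0 ?expR_ge0.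
  - apply/measurable_EFinP/measurable_funTS/measurable_funM => //.
    by apply: measurableT_comp => //; exact: measurable_oppr.
  - move=> x /=; rewrite in_itv/= => /andP[Nx xN]; rewrite lee_fin.
    apply: ler_pM; rewrite ?powR_ge0 ?expR_ge0//.
      by apply: ge0_ler_powR; rewrite ?nnegrE ?subr_ge0// ?(ltW N0)// (le_trans (ltW N0)).
    by rewrite ler_expR lerN2.
apply: ge0_subset_integral => //.
- apply/measurable_EFinP/measurable_funTS/measurable_funM => //.
  by apply: measurableT_comp => //; exact: measurable_oppr.
- by move=> x _; rewrite lee_fin mulr_ge0 ?powR_ge0 ?expR_ge0.
- move=> x /=; rewrite !in_itv/= andbT => /andP[Nx _]; exact: lt_le_trans Nx.
Qed.

Lemma egamma_gt0 a : 0 < a -> (0 < egamma a)%E.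
Proof.
move=> a0; have : (0 < egamma (1 + a))%E.
  apply: lt_le_trans (egamma_ge _ ltr01); last by rewrite lerDl ltW.
  by rewrite lte_fin powR1 mul1r expR_gt0.
rewrite egammaS//; have := egamma_ge0 a; rewrite le_eqVlt => /predU1P[<-|//].
by rewrite mule0 ltxx.
Qed.

Lemma GammaE a : 0 < a -> (Gamma a)%:E = egamma a.
Proof.
move=> a0; rewrite /Gamma a0 big_ord0 divr1 addr0 egammaE /Gamma_integral.
rewrite /Rintegral fineK// -egammaE fin_numElt egamma_lty// andbT.
exact: lt_le_trans (egamma_ge0 a).
Qed.

Lemma Gamma_gt0 a : 0 < a -> 0 < Gamma a.
Proof. by move=> a0; rewrite -lte_fin GammaE// egamma_gt0. Qed.

Lemma Gamma1 : Gamma 1 = 1 :> R.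
Proof. by apply: EFin_inj; rewrite GammaE// egamma1. Qed.

Lemma Gamma_ge a N : 1 <= a -> 0 < N -> N `^ (a - 1) * expR (- (N + 1)) <= Gamma a.
Proof.
by move=> a1 N0; rewrite -lee_fin GammaE ?egamma_ge// (lt_le_trans ltr01).
Qed.

(** Divide [egammaM] by Gamma(a + b). An infinite Beta integral is excluded, since its product with
    Gamma(a + b) > 0 would be infinite. *)
Lemma ebetaE a b : 0 < a -> 0 < b ->
  ebeta a b 1 = (Gamma a * Gamma b / Gamma (a + b))%:E.
Proof.
move=> a0 b0; have ab0 : 0 < a + b by rewrite addr_gt0.
have := egammaM a b; rewrite -!GammaE// -EFinM.
have := ebeta_ge0 a b 1; have := Gamma_gt0 ab0; case: (ebeta a b 1) => [r| |]//.
  by move=> g0 _ [->]; rewrite mulfK// gt_eqF.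
by move=> g0 _; rewrite gt0_mulye.
Qed.

Definition kern a x : R := pospow a x / Gamma a.

Lemma kern_ge0 a x : 0 < a -> 0 <= kern a x.
Proof. by move=> a0; rewrite divr_ge0 ?pospow_ge0// ltW// Gamma_gt0. Qed.

Lemma kern_le0 a x : x <= 0 -> kern a x = 0.
Proof. by move=> x0; rewrite /kern pospow_le0// mul0r. Qed.

Lemma kern_gt0 a x : 0 < x -> kern a x = x `^ (a - 1) / Gamma a.
Proof. by move=> x0; rewrite /kern pospow_gt0. Qed.

Lemma kern1 x : 0 < x -> kern 1 x = 1.
Proof. by move=> x0; rewrite kern_gt0// subrr powRr0 Gamma1 divr1. Qed.

Lemma le_kern a x y : 1 <= a -> x <= y -> kern a x <= kern a y.
Proof.
move=> a1 xy; have a0 : 0 < a by rewrite (lt_le_trans ltr01).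
have [x0|x0] := leP x 0; first by rewrite (kern_le0 _ x0) kern_ge0.
have y0 := lt_le_trans x0 xy.
rewrite !kern_gt0// ler_pM2r ?invr_gt0 ?Gamma_gt0//.
by apply: ge0_ler_powR; rewrite ?nnegrE ?subr_ge0// ltW.
Qed.

Lemma measurable_kern a : measurable_fun [set: R] (kern a).
Proof. by apply: measurable_funM => //; exact: measurable_pospow. Qed.

Lemma kern_conv a b t z : 0 < a -> 0 < b ->
  (\int[mu]_x (kern a (x - t) * kern b (z - x))%:E = (kern (a + b) (z - t))%:E)%E.
Proof.
move=> a0 b0.
pose f x := (kern a x * kern b (z - t - x))%:E.
have mf : measurable_fun [set: R] f.
  apply/measurable_EFinP/measurable_funM; first exact: measurable_kern.
  by apply: (measurableT_comp (measurable_kern b)); exact: measurable_funB.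
rewrite -(ge0_integral_shift t) /=; last 2 first.
- apply/measurable_EFinP/measurable_funM.
    by apply: (measurableT_comp (measurable_kern a)); exact: measurable_funB.
  by apply: (measurableT_comp (measurable_kern b)); exact: measurable_funB.
- by move=> x; rewrite lee_fin mulr_ge0 ?kern_ge0.
under eq_integral => x _.
  rewrite addrK (_ : z - (x + t) = z - t - x) ?/kern; last by ring.
  rewrite mulrACA mulrC EFinM.
  over.
rewrite ge0_integralZl//; last 3 first.
- apply/measurable_EFinP/measurable_funM; first exact: measurable_pospow.
  exact: measurable_pospow_shift.
- by move=> x _; rewrite lee_fin mulr_ge0 ?pospow_ge0.
- by rewrite lee_fin mulr_ge0// invr_ge0 ltW// Gamma_gt0.
rewrite -/(ebeta a b (z - t)) ebetaZ ebetaE// -!EFinM; congr EFin.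
rewrite /kern; field.
by rewrite !gt_eqF ?Gamma_gt0 ?addr_gt0.
Qed.

End gamma_beta.

(** * Fractional integrals of real functions *)

Section fracint.
Variable R : realType.
Notation mu := (@lebesgue_measure R).
Implicit Types (a b c s t : R) (f g : R -> R).

(** The factor 1 / Gamma(a) sits inside the kernel, unlike in [RL_integral]; the two agree for
    positive orders, as [RL_integralE] shows. *)
Definition fracint a f t : R := \int[mu]_(x in `]t, 0[) (kern a (x - t) * f x).

Definition frac_cv a f t : Prop :=
  mu.-integrable `]t, 0[ (fun x => (kern a (x - t) * f x)%:E).

Lemma measurable_kern_shift a t : measurable_fun [set: R] (fun x => kern a (x - t)).
Proof. by apply: (measurableT_comp (measurable_kern a)); exact: measurable_funB. Qed.

Lemma measurable_kern_rshift a t : measurable_fun [set: R] (fun x => kern a (t - x)).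
Proof. by apply: (measurableT_comp (measurable_kern a)); exact: measurable_funB. Qed.

Lemma kern_conv_integrable a b t z : 0 < a -> 0 < b ->
  mu.-integrable [set: R] (fun x => (kern a (x - t) * kern b (z - x))%:E).
Proof.
move=> a0 b0; apply/integrableP; split.
  apply/measurable_EFinP/measurable_funM; first exact: measurable_kern_shift.
  exact: measurable_kern_rshift.
under eq_integral => x _ do
  rewrite gee0_abs ?lee_fin ?(mulr_ge0 (kern_ge0 _ a0) (kern_ge0 _ b0))//.
by rewrite kern_conv// ltry.
Qed.

(* No integrability is needed: both sides are 0 when an integral diverges. *)
Lemma gt0_RintegralZl (D : set R) f c : measurable D -> measurable_fun D f -> 0 < c ->
  \int[mu]_(x in D) (c * f x) = c * \int[mu]_(x in D) f x.
Proof.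
move=> mD mf c0; rewrite /Rintegral.
have cE x : ((c * f x)%:E = c%:E * (f x)%:E)%E by rewrite EFinM.
under eq_integral => x _ do rewrite cE.
rewrite [in LHS]integralE [in RHS]integralE.
rewrite (ge0_funeposM _ (ltW c0)) (ge0_funenegM _ (ltW c0)).
have mp := measurable_funepos ((measurable_EFinP _ _).2 mf).
have mn := measurable_funeneg ((measurable_EFinP _ _).2 mf).
rewrite !ge0_integralZl_EFin ?(ltW c0)//.
have gen (p n : \bar R) : (0 <= p -> 0 <= n ->
    fine (c%:E * p - c%:E * n) = (c * fine (p - n))%R)%E.
  case: p => [p| |] //; case: n => [n| |]// _ _; last 3 first.
  - by rewrite gt0_muley//= mulr0.
  - by rewrite gt0_muley//= mulr0.
  - by rewrite gt0_muley//= mulr0.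
  by rewrite -!EFinM -!EFinB/= mulrBr.
by apply: gen; exact: integral_ge0.
Qed.

(** Fubini's theorem yields inner integrals in the extended reals, infinite on a null set at most,
    while [fracint] is real-valued. *)
Lemma integrable_fine (D : set R) (F : R -> \bar R) : measurable D ->
  mu.-integrable D F ->
  mu.-integrable D (fun x => (fine (F x))%:E) /\
  (\int[mu]_(x in D) (fine (F x))%:E = \int[mu]_(x in D) F x)%E.
Proof.
move=> mD iF; have mF := measurable_int _ iF.
have mfF : measurable_fun D (fun x => (fine (F x))%:E).
  apply/measurable_EFinP; exact: (measurableT_comp _ mF).
have ifF : mu.-integrable D (fun x => (fine (F x))%:E).
  apply: le_integrable iF => //.
  by move=> x _; case: (F x) => [r| |]//=; rewrite ?normr0 ?leey.
split=> //; apply: ae_eq_integral => //.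
move/integrable_ae : iF => /(_ mD); apply: filterS => x /= + Dx => /(_ Dx) fin.
by rewrite fineK.
Qed.

(** Convergence of the outer integral is part of the conclusion: it is the source of convergence for
    orders below 1. *)
Lemma fracint_semigroup a b f t : 0 < a -> 0 < b ->
  measurable_fun `]t, 0[ f -> frac_cv (a + b) f t ->
  frac_cv a (fracint b f) t /\ fracint a (fracint b f) t = fracint (a + b) f t.
Proof.
move=> a0 b0 mf cvf.
(* kern a (x - t) * kern b (z - x) vanishes unless t < x < z: with f cut off
   outside ]t, 0[, the double integral may run over the plane. *)
pose f' : R -> R := f \_ `]t, 0[.
have mf' : measurable_fun [set: R] f'.
  by apply/(measurable_restrictT f) => //; exact: measurable_itv.
pose G (w : R * R) : \bar R := (kern a (w.1 - t) * kern b (w.2 - w.1) * f' w.2)%:E.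
have mG : measurable_fun [set: R * R] G.
  apply/measurable_EFinP/measurable_funM; last exact: (measurableT_comp mf').
  apply: measurable_funM.
    by apply: (measurableT_comp (measurable_kern a)); exact: measurable_funB.
  by apply: (measurableT_comp (measurable_kern b)); exact: measurable_funB.
have f'E c x z : t <= x -> kern c (z - x) * f' z = ((fun z => kern c (z - x) * f z) \_ `]x, 0[) z.
  move=> tx; rewrite /f' !patchE !mem_setE !in_itv/=.
  have [zx|xz] := leP z x; first by rewrite kern_le0 ?mul0r// subr_le0.
  by rewrite (le_lt_trans tx xz)/=; case: ifPn => //; rewrite mulr0.
have inner z : (\int[mu]_x G (x, z) = (kern (a + b) (z - t) * f' z)%:E)%E.
  rewrite EFinM -kern_conv// -integralZr//; last exact: kern_conv_integrable.
have cvE : mu.-integrable [set: R] (fun z => (kern (a + b) (z - t) * f' z)%:E).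
  have /(integrable_mkcond _ _) := cvf; move=> /(_ (measurable_itv _)).
  apply: eq_integrable => // z _.
  by rewrite f'E// !patchE; case: ifPn.
(* Tonelli, integrating the absolute value over x first: the kernels are nonnegative and convolve to
   [kern (a + b) (z - t)], so [cvE] bounds the result. *)
have iG : (mu \x mu)%E.-integrable [set: R * R] G.
  apply/(integrable21ltyP mu mu mG).
  move/integrableP: cvE => [_]; apply: le_lt_trans.
  apply: ge0_le_integral => //.
  - by move=> z _; exact: integral_ge0.
  - apply: (@measurable_fun_fubini_tonelli_G _ _ _ _ R mu (abse \o G)) => //=.
    exact: measurableT_comp.
  - apply/measurableT_comp/measurable_EFinP/measurable_funM => //.
    exact: measurable_kern_shift.
  - move=> z _ /=.
    rewrite normrM EFinM (ger0_norm (kern_ge0 _ (addr_gt0 a0 b0))) -kern_conv//.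
    rewrite -integralZr//; last exact: kern_conv_integrable.
    rewrite le_eqVlt; apply/orP; left; apply/eqP; apply: eq_integral => x _.
    by rewrite normrM EFinM ger0_norm// mulr_ge0// kern_ge0.
pose E x := (\int[mu]_z G (x, z))%E.
have iE : mu.-integrable [set: R] E by exact: (integrable_fubini_F iG).
have [ifE fE] := integrable_fine (measurableT) iE.
have EE x : fine (E x) = ((fun x => kern a (x - t) * fracint b f x) \_ `]t, 0[) x.
  rewrite patchE mem_setE in_itv/=; have [tx|xt] := ltP t x => /=; last first.
    rewrite /E integral0_eq// => z _; rewrite /G/= kern_le0 ?mul0r// subr_le0//.
  have [x0|x0] := ltP x 0; last first.
    rewrite /E integral0_eq// => z _; rewrite /G/= -mulrA f'E ?(ltW tx)//.
    rewrite patchE mem_setE in_itv/= ; case: ifPn => //; last by rewrite mulr0.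
    by move=> /andP[xz z0]; have := lt_le_trans (lt_trans xz z0) x0; rewrite ltxx.
  (* A positive factor leaves the inner integral even where that integral diverges, so the equality
     holds at every x. *)
  have ka : 0 < kern a (x - t).
    by rewrite kern_gt0 ?subr_gt0// divr_gt0 ?powR_gt0 ?subr_gt0// Gamma_gt0.
  have -> : fracint b f x = fine (\int[mu]_z (kern b (z - x) * f' z)%:E)%E.
    rewrite /fracint Rintegral_mkcond /Rintegral; congr fine.
    by apply: eq_integral => z _; rewrite f'E// ltW.
  rewrite -[fine (integral _ _ _)]/(\int[mu]_z (kern b (z - x) * f' z)).
  rewrite -gt0_RintegralZl//; last first.
    by apply: measurable_funM => //; exact: measurable_kern_shift.
  rewrite /E /Rintegral; congr fine.
  apply: eq_integral => z _; exact: (congr1 EFin (esym (mulrA _ _ _))).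
split.
  apply/(integrable_mkcond _ _); first exact: measurable_itv.
  apply: eq_integrable ifE => // x _; rewrite EE !patchE; by case: ifPn.
rewrite {1}/fracint Rintegral_mkcond /Rintegral.
under eq_integral => x _ do rewrite -EE.
rewrite fE /E.
have -> : (\int[mu]_x \int[mu]_z G (x, z) = \int[mu]_z \int[mu]_x G (x, z))%E.
  exact: (Fubini iG).
rewrite /fracint Rintegral_mkcond /Rintegral; congr fine.
by apply: eq_integral => z _; rewrite inner f'E.
Qed.

Lemma eq_fracint a f g t : {in `]t, 0[, f =1 g} -> fracint a f t = fracint a g t.
Proof.
move=> fg; apply: eq_Rintegral => x; rewrite inE/= => xt.
by rewrite fg.
Qed.

Lemma eq_frac_cv a f g t : {in `]t, 0[, f =1 g} -> frac_cv a f t -> frac_cv a g t.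
Proof.
move=> fg; apply: eq_integrable => // x; rewrite inE/= => xt.
by rewrite fg.
Qed.

Lemma fracint1E f t : fracint 1 f t = \int[mu]_(x in `]t, 0[) f x.
Proof.
apply: eq_Rintegral => x; rewrite inE/= in_itv/= => /andP[tx _].
by rewrite kern1 ?mul1r// subr_gt0.
Qed.

Lemma frac_cv1 f t : frac_cv 1 f t <-> mu.-integrable `]t, 0[ (EFin \o f).
Proof.
by split; apply: eq_integrable => // x; rewrite inE/= in_itv/= => /andP[tx _];
  rewrite kern1 ?mul1r// subr_gt0.
Qed.

Lemma integrable_itvSr f s t : s <= t ->
  mu.-integrable `]s, 0[ (EFin \o f) -> mu.-integrable `]t, 0[ (EFin \o f).
Proof. by move=> st; apply: integrableS => //; apply: subset_itvr. Qed.

Lemma integrable_EFin_measurable (D : set R) f : mu.-integrable D (EFin \o f) -> measurable_fun D f.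
Proof. by move/measurable_int/measurable_EFinP. Qed.

Lemma integrable_RZl (D : set R) c f : measurable D ->
  mu.-integrable D (EFin \o f) -> mu.-integrable D (EFin \o (fun x => c * f x)).
Proof.
move=> mD intf; apply: eq_integrable (integrableZl _ c intf) => //.
Qed.

Lemma integrable_RD (D : set R) f g : measurable D ->
  mu.-integrable D (EFin \o f) -> mu.-integrable D (EFin \o g) ->
  mu.-integrable D (EFin \o (fun x => f x + g x)).
Proof.
move=> mD intf intg; apply: eq_integrable (integrableD _ intf intg) => //.
Qed.

(** For a >= 1 the kernel is nondecreasing, hence bounded on the interval by its value at - t. *)
Lemma frac_cv_ge1 a f t : 1 <= a -> mu.-integrable `]t, 0[ (EFin \o f) -> frac_cv a f t.
Proof.
move=> a1 intf; have a0 : 0 < a by rewrite (lt_le_trans ltr01).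
have mf := integrable_EFin_measurable intf.
apply: (@le_integrable _ _ _ mu _ _ _ (EFin \o (fun x => kern a (- t) * f x))) => //.
- apply/measurable_EFinP/measurable_funM => //.
  by apply: measurable_funTS; exact: measurable_kern_shift.
- move=> x; rewrite /= in_itv/= => /andP[_ x0].
  rewrite lee_fin [leLHS]normrM [leRHS]normrM ler_wpM2r//.
  rewrite [leLHS]ger0_norm ?[leRHS]ger0_norm ?kern_ge0//.
  by rewrite le_kern// lerBlDr addNr ltW.
- exact: integrable_RZl.
Qed.

(** The bound depends on s only, so it is uniform in t; it controls the remainder of the iterated
    Volterra equation. *)
Lemma fracint_le a f s t : 1 <= a -> s <= t -> mu.-integrable `]s, 0[ (EFin \o f) ->
  `|fracint a f t| <= kern a (- s) * \int[mu]_(x in `]s, 0[) `|f x|.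
Proof.
move=> a1 st intf; have a0 : 0 < a by rewrite (lt_le_trans ltr01).
have cvf : frac_cv a f t by apply: frac_cv_ge1 => //; exact: integrable_itvSr intf.
have nf : mu.-integrable `]s, 0[ (fun x => `|f x|%:E) by exact: integrable_norm.
apply: le_trans (le_normr_Rintegral _ cvf) _ => //.
rewrite -RintegralZl//.
apply: (@le_trans _ _ (\int[mu]_(x in `]t, 0[) (kern a (- s) * `|f x|))).
  apply: le_Rintegral => //.
  - exact: integrable_norm.
  - apply: integrable_RZl => //; exact: integrable_itvSr nf.
  - move=> x; rewrite /= in_itv/= => /andP[_ x0].
    rewrite normrM ler_wpM2r// ger0_norm ?kern_ge0// le_kern//.
    by rewrite -[leRHS]add0r lerB// ltW.
rewrite /Rintegral fine_le//.
- apply: integrable_fin_num => //; apply: integrable_RZl => //; exact: integrable_itvSr nf.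
- by apply: integrable_fin_num => //; exact: integrable_RZl.
- apply: ge0_subset_integral => //.
  + by apply: (@measurable_int _ _ _ mu); exact: integrable_RZl.
  + by move=> x _; rewrite lee_fin mulr_ge0// kern_ge0.
  + exact: subset_itvr.
Qed.

(** Integrability of I^a f on []s, 0[] is convergence of I^1 I^a f at s, which the semigroup law
    provides because 1 + a >= 1. *)
Lemma fracint_integrable a f s : 0 < a -> mu.-integrable `]s, 0[ (EFin \o f) ->
  mu.-integrable `]s, 0[ (EFin \o fracint a f).
Proof.
move=> a0 intf; apply/frac_cv1.
have mf := integrable_EFin_measurable intf.
have /(fracint_semigroup ltr01 a0 mf)[] // : frac_cv (1 + a) f s.
by apply: frac_cv_ge1 => //; rewrite lerDl ltW.
Qed.

Lemma kern_shift_integrable a t : 0 < a -> mu.-integrable `]t, 0[ (fun x => (kern a (x - t))%:E).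
Proof.
move=> a0.
have : mu.-integrable `]t, 0[ (fun x => (kern a (x - t) * kern 1 (0 - x))%:E).
  apply: (integrableS measurableT) => //; exact: kern_conv_integrable.
apply: eq_integrable => // x; rewrite inE/= in_itv/= => /andP[_ x0].
by rewrite kern1 ?mulr1// sub0r oppr_gt0.
Qed.

(** The convolution of kernels with z = 0: the product vanishes outside []t, 0[]. *)
Lemma fracint_kern a b t : 0 < a -> 0 < b ->
  frac_cv b (fun x => kern a (- x)) t /\
  fracint b (fun x => kern a (- x)) t = kern (b + a) (- t).
Proof.
move=> a0 b0.
have E x : (kern b (x - t) * kern a (0 - x)) =
   ((fun x => kern b (x - t) * kern a (- x)) \_ `]t, 0[) x.
  rewrite sub0r patchE mem_setE in_itv/=; have [tx|xt] := ltP t x => /=; last first.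
    by rewrite kern_le0 ?mul0r// subr_le0.
  by have [//|x0] := ltP x 0; rewrite [X in _ * X]kern_le0 ?mulr0// oppr_le0.
split.
  apply/integrable_mkcond; first exact: measurable_itv.
  apply: eq_integrable (kern_conv_integrable t 0 b0 a0) => // x _.
  by rewrite E !patchE; case: ifPn.
apply: EFin_inj; rewrite -(sub0r t) -kern_conv//.
rewrite /fracint Rintegral_mkcond /Rintegral.
under [in RHS]eq_integral => x _ do rewrite E.
rewrite fineK//; apply: integrable_fin_num => //.
by apply: eq_integrable (kern_conv_integrable t 0 b0 a0) => // x _; rewrite E.
Qed.

Lemma frac_cvD a f g t : frac_cv a f t -> frac_cv a g t -> frac_cv a (fun x => f x + g x) t.
Proof.
move=> cf cg; apply: eq_integrable (integrableD _ cf cg) => // x _.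
by rewrite -EFinD mulrDr.
Qed.

Lemma fracintD a f g t : frac_cv a f t -> frac_cv a g t ->
  fracint a (fun x => f x + g x) t = fracint a f t + fracint a g t.
Proof.
move=> cf cg; rewrite /fracint -RintegralD//.
by apply: eq_Rintegral => x _; rewrite mulrDr.
Qed.

Lemma frac_cvZ a c f t : frac_cv a f t -> frac_cv a (fun x => c * f x) t.
Proof.
move=> cf; apply: eq_integrable (integrableZl _ c cf) => // x _.
by rewrite -EFinM mulrCA.
Qed.

Lemma fracintZ a c f t : frac_cv a f t -> fracint a (fun x => c * f x) t = c * fracint a f t.
Proof.
move=> cf; rewrite /fracint -RintegralZl//.
by apply: eq_Rintegral => x _; rewrite mulrCA.
Qed.

End fracint.

(** * Continuity and differentiation of the integral of order 1 *)

Section ftc.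
Variable R : realType.
Notation mu := (@lebesgue_measure R).
Implicit Types (a b c s t : R) (f g : R -> R).

Lemma in_itv_oo_near s b t : t \in `]s, b[ -> \forall x \near t, x \in `]s, b[.
Proof. by move=> tsb; exact: (near_in_itvoo tsb). Qed.

Section primitive.
Variables (s : R) (f : R -> R).
Hypothesis s0 : s < 0.
Hypothesis intf : mu.-integrable `]s, 0[ (EFin \o f).

(** Cutting f off makes it integrable on every interval. With [P] its primitive from the fixed end
    s, I^1 f(t) = P(0) - P(t), which moves the variable bound to the upper end. *)
Let f' : R -> R := f \_ `]s, 0[.
Let P t := \int[mu]_(x in `[s, t]) f' x.

Let intf' (D : set R) : measurable D -> mu.-integrable D (EFin \o f').
Proof.
move=> mD; apply: (@integrableS _ _ _ mu setT) => //.
have /integrable_mkcond := intf; move=> /(_ (measurable_itv _)).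
by rewrite restrict_EFin.
Qed.

Let f'E x : x \in `]s, 0[ -> f' x = f x.
Proof. by move=> x0; rewrite /f' patchE mem_setE x0. Qed.

Let fracintP t : s <= t -> t <= 0 -> fracint 1 f t = P 0 - P t.
Proof.
move=> st t0; rewrite fracint1E Rintegral_itvB ?bnd_simp//; last exact: intf'.
rewrite -Rintegral_itv_bndo_bndc; last exact: intf'.
apply: eq_Rintegral => x; rewrite inE/= => xt; rewrite f'E//.
by move: xt; rewrite !in_itv/= => /andP[/(le_lt_trans st) -> ->].
Qed.

Let cP : {within `[s, 0], continuous P}.
Proof. apply: parameterized_integral_continuous; [exact: ltW|exact: intf']. Qed.

Let near_fracintP t : t \in `]s, 0[ -> \forall x \near t, fracint 1 f x = P 0 - P x.
Proof.
move=> /in_itv_oo_near; apply: filterS => x; rewrite in_itv/= => /andP[sx x0].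
by rewrite fracintP// ltW.
Qed.

Lemma fracint1_continuous : {in `]s, 0[, continuous (fracint 1 f)}.
Proof.
move=> t ts; have [cPo _ _] := (continuous_within_itvP _ s0).1 cP.
have cPt : {for t, continuous (fun x => P 0 - P x)}.
  by apply: cvgB; [exact: cvg_cst|exact: cPo].
rewrite /continuous_at (nbhs_singleton (near_fracintP ts)).
apply: cvg_trans cPt; apply: near_eq_cvg.
by move: (near_fracintP ts); apply: filterS => x ->.
Qed.

Lemma fracint1_cvg0 : fracint 1 f t @[t --> 0^'-] --> 0.
Proof.
have [_ _ cP0] := (continuous_within_itvP _ s0).1 cP.
have c0 : P 0 - P t @[t --> 0^'-] --> 0.
  by rewrite -[X in _ --> X](subrr (P 0)); apply: cvgB => //; exact: cvg_cst.
apply: cvg_trans c0; apply: near_eq_cvg; near=> t.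
have t0 : t <= 0 by near: t; exact: nbhs_left_le.
have st : s <= t by near: t; exact: nbhs_left_ge.
by rewrite fracintP.
Unshelve. all: by end_near. Qed.

Let is_derive_fracint t : t \in `]s, 0[ ->
  derivable P t 1 /\ (P^`())%classic t = f' t -> is_derive t 1 (fracint 1 f) (- f t).
Proof.
move=> ts [dP dPE]; rewrite -(f'E ts).
have dPt : is_derive t 1 P (f' t) by apply: (DeriveDef dP); rewrite -derive1E.
have d : is_derive t 1 (fun x => P 0 - P x) (- f' t).
  apply: (is_derive_eq (is_deriveB (is_derive_cst (P 0) t 1) dPt)).
  by rewrite sub0r.
apply: near_eq_is_derive d.
by move: (near_fracintP ts); apply: filterS => x ->.
Qed.

Lemma fracint1_derive t : t \in `]s, 0[ -> {for t, continuous f} ->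
  is_derive t 1 (fracint 1 f) (- f t).
Proof.
move=> ts ct; apply: is_derive_fracint => //.
have cf' : {for t, continuous f'}.
  rewrite /prop_for /continuous_at (f'E ts); apply: cvg_trans ct; apply: near_eq_cvg.
  by move: (in_itv_oo_near ts); apply: filterS => x /f'E ->.
move: ts; rewrite in_itv/= => /andP[st t0].
apply: (@continuous_FTC1 _ f' (BLeft s) t 0) => //; exact: intf'.
Qed.

(** Lebesgue's differentiation theorem: for an integrand that is merely integrable, the derivative
    exists only almost everywhere. *)
Lemma fracint1_derive_ae :
  {ae mu, forall t, t \in `]s, 0[ -> is_derive t 1 (fracint 1 f) (- f t)}.
Proof.
have loc : locally_integrable [set: R] f'.
  apply: open_integrable_locally; first exact: openT.
  apply: intf'; exact: measurableT.
have := @FTC1 _ f' (BLeft s) (fun y => intf' (measurable_itv _)) loc.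
apply: filterS; first exact: (ae_filter_ringOfSetsType mu).
move=> t H ts; apply: is_derive_fracint => //.
move: ts; rewrite in_itv/= => /andP[st _]; apply: H. by rewrite lte_fin.
Qed.

End primitive.

End ftc.

(** * Integrals and null sets, without measurability *)

Section null_modification.
Variable R : realType.
Notation mu := (@lebesgue_measure R).
Local Open Scope ereal_scope.

Import HBNNSimple.

(** The integral of F is a supremum over simple functions below F. Replacing such a function by 0 on
    N keeps its integral and puts it below G, so the argument covers non-measurable F and G. *)
Lemma le_integral_null (F G : R -> \bar R) (N : set R) : measurable N -> mu N = 0 ->
  (forall x, 0 <= F x) -> (forall x, 0 <= G x) ->
  (forall x, ~ N x -> F x = G x) -> \int[mu]_x F x <= \int[mu]_x G x.
Proof.
move=> mN N0 F0 G0 FG.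
rewrite ge0_integralTE//; apply: ge_ereal_sup => _ [h hF <-].
have mNC : measurable (~` N) by exact: measurableC.
pose h' := proj_nnsfun h mNC.
have -> : sintegral mu h = sintegral mu h'.
  rewrite -!integralT_nnsfun; apply: ge0_ae_eq_integral => //.
  - exact/measurable_EFinP.
  - exact/measurable_EFinP.
  - by move=> x _; rewrite lee_fin.
  - by move=> x _; rewrite lee_fin.
  exists N; split => // x /= hx; apply: contrapT => Nx; apply: hx => _.
  by rewrite /mindic indicE mem_set ?mulr1.
rewrite ge0_integralTE//; apply: ereal_sup_ubound; exists h' => // x.
rewrite /= /mindic indicE; have [xN|xN] := boolP (x \in ~` N); last by rewrite mulr0.
by rewrite mulr1 -FG//; exact/set_mem.
Qed.

(* The Lebesgue measure on the Borel sets is not complete: f need not be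
   measurable. *)
Lemma integral_null (D : set R) (f g : R -> \bar R) (N : set R) :
  measurable N -> mu N = 0 ->
  (forall x, D x -> ~ N x -> f x = g x) ->
  \int[mu]_(x in D) f x = \int[mu]_(x in D) g x.
Proof.
move=> mN N0 fg; rewrite integral_mkcond [RHS]integral_mkcond.
have {}fg x : ~ N x -> (f \_ D) x = (g \_ D) x.
  by move=> Nx; rewrite !patchE; case: ifPn => // /set_mem /fg; exact.
rewrite integralE [RHS]integralE; congr (_ - _); apply/eqP; rewrite eq_le.
  by apply/andP; split; apply: (le_integral_null mN N0) => // x Nx; rewrite !funeposE fg.
by apply/andP; split; apply: (le_integral_null mN N0) => // x Nx; rewrite !funenegE fg.
Qed.

Lemma ae_imply (P Q : R -> Prop) : (forall x, P x -> Q x) ->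
  {ae mu, forall x, P x} -> {ae mu, forall x, Q x}.
Proof. by move=> PQ; apply: filterS => //; exact: (ae_filter_ringOfSetsType mu). Qed.

Lemma ae_imply2 (P Q S : R -> Prop) : (forall x, P x -> Q x -> S x) ->
  {ae mu, forall x, P x} -> {ae mu, forall x, Q x} -> {ae mu, forall x, S x}.
Proof. by move=> PQS; apply: filterS2 => //; exact: (ae_filter_ringOfSetsType mu). Qed.

Lemma ae_eq_Rintegral (D : set R) (f g : R -> R) :
  {ae mu, forall x, D x -> f x = g x} ->
  (\int[mu]_(x in D) f x = \int[mu]_(x in D) g x)%R.
Proof.
move=> [N [mN N0 sN]]; rewrite /Rintegral; congr fine.
apply: (integral_null mN N0) => x Dx Nx; congr EFin; apply: contrapT => fg.
by apply: Nx; apply: sN => /= /(_ Dx).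
Qed.

End null_modification.

(** * Taylor's formula of order two at 0 *)

Section taylor.
Variable R : realType.
Notation mu := (@lebesgue_measure R).
Implicit Types (a b c s t : R) (f g v w : R -> R).

Lemma fracint1_fracint1 f s t : s <= t -> mu.-integrable `]s, 0[ (EFin \o f) ->
  fracint 1 (fracint 1 f) t = fracint (1 + 1) f t.
Proof.
move=> st /(integrable_itvSr st) intf.
have mf := integrable_EFin_measurable intf.
have cv : frac_cv (1 + 1) f t by apply: frac_cv_ge1 => //; rewrite lerDl.
by have [_ ->] := fracint_semigroup ltr01 ltr01 mf cv.
Qed.

Lemma fracint2_derive f s t : s < 0 -> mu.-integrable `]s, 0[ (EFin \o f) ->
  t \in `]s, 0[ -> is_derive t 1 (fracint (1 + 1) f) (- fracint 1 f t).
Proof.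
move=> s0 intf ts.
apply: near_eq_is_derive (fracint1_derive (fracint_integrable ltr01 intf) ts _).
  have := in_itv_oo_near ts; apply: filterS => x; rewrite in_itv/= => /andP[sx _].
  by rewrite (fracint1_fracint1 _ intf)// ltW.
exact: (fracint1_continuous s0 intf ts).
Qed.

Lemma fracint2_cvg0 f s : s < 0 -> mu.-integrable `]s, 0[ (EFin \o f) ->
  fracint (1 + 1) f t @[t --> 0^'-] --> 0.
Proof.
move=> s0 intf.
have := fracint1_cvg0 s0 (fracint_integrable ltr01 intf).
apply: cvg_trans; apply: near_eq_cvg; near=> t.
rewrite (fracint1_fracint1 _ intf)//; near: t; exact: nbhs_left_ge.
Unshelve. all: by end_near. Qed.

Lemma Rintegral_fracint1 f s x y : s < x -> x <= y -> y < 0 ->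
  mu.-integrable `]s, 0[ (EFin \o f) ->
  \int[mu]_(z in `[x, y]) f z = fracint 1 f x - fracint 1 f y.
Proof.
move=> sx xy y0 intf; have x0 := le_lt_trans xy y0.
have intx : mu.-integrable `[x, 0[ (EFin \o f).
  apply: integrableS intf => //; exact: subset_itvr.
have intx' : mu.-integrable `[x, y] (EFin \o f).
  by apply: integrableS intx => //; apply: subset_itvl.
rewrite !fracint1E (Rintegral_itv_obnd_cbnd (b := BLeft 0)); last first.
  exact: integrable_itvSr (ltW sx) intf.
rewrite -(Rintegral_itvB (x := y) intx) ?bnd_simp//.
by rewrite opprB addrC subrK.
Qed.

Lemma derive0_cst f s x y : {in `]s, 0[, forall t, is_derive t 1 f 0} ->
  x \in `]s, 0[ -> y \in `]s, 0[ -> f x = f y.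
Proof.
move=> df; wlog xy : x y / x <= y.
  by move=> H; have [xy|/ltW yx] := leP x y => xs ys; [exact: H|apply/esym; exact: H].
move=> xs ys; apply/eqP; rewrite eq_sym -subr_eq0; apply/eqP.
have sub z : z \in `[x, y] -> z \in `]s, 0[.
  move: xs ys; rewrite !in_itv/= => /andP[sx _] /andP[_ y0] /andP[xz zy].
  by rewrite (lt_le_trans sx)//= (le_lt_trans zy).
have [|//|z _ ->] := @MVT_segment R f (fun=> 0) x y xy; last by rewrite mul0r.
  move=> z zxy; apply: df; apply: sub; exact: subset_itv_oo_cc.
apply: continuous_in_subspaceT => z; rewrite inE/= => /sub zs.
by have ? := df _ zs; exact/differentiable_continuous/derivable1_diffP.
Qed.

(** By the formula for increments, w + I^1 v is constant, and its limit at 0 from the left is l.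
    This serves both for w' with its derivative v and for g with g'. *)
Lemma fracint1_left_limit s w v (l : R) : s < 0 -> mu.-integrable `]s, 0[ (EFin \o v) ->
  (forall x y, s < x -> x <= y -> y < 0 -> w y - w x = \int[mu]_(z in `[x, y]) v z) ->
  w t @[t --> 0^'-] --> l ->
  {in `]s, 0[, forall t, w t = l - fracint 1 v t}.
Proof.
move=> s0 intv incr wl.
have aux1 (a b c d : R) : a - b = c - d -> b + c = a + d.
  by move=> /eqP; rewrite subr_eq => /eqP ->; ring.
move=> t; rewrite in_itv/= => /andP[st t0]; apply/eqP; rewrite -subr_eq opprK; apply/eqP.
have c1 : w y + fracint 1 v y @[y --> 0^'-] --> l.
  rewrite -[X in _ --> X]addr0; apply: cvgD => //; exact: (fracint1_cvg0 s0 intv).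
have c2 : w y + fracint 1 v y @[y --> 0^'-] --> w t + fracint 1 v t.
  apply: (@cvg_trans _ (cst (w t + fracint 1 v t) @ 0^'-)); last exact: cvg_cst.
  apply: near_eq_cvg; near=> y.
  have ty : t <= y by near: y; exact: nbhs_left_ge.
  have y0 : y < 0 by near: y; exact: nbhs_left_lt.
  have := incr _ _ st ty y0; rewrite (Rintegral_fracint1 st ty y0 intv)/=.
  exact: aux1.
exact: (cvg_unique _ c2 c1).
Unshelve. all: by end_near. Qed.

(** Since w' = xi1 - I^1 v, the difference [q] has derivative 0 at every point; its constant value
    is its limit xi0. No pointwise second derivative enters. *)
Lemma taylor2 s w v (xi0 xi1 : R) : s < 0 -> mu.-integrable `]s, 0[ (EFin \o v) ->
  {in `]s, 0[, forall t, derivable w t 1} ->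
  (forall x y, s < x -> x <= y -> y < 0 ->
    derive1 w y - derive1 w x = \int[mu]_(z in `[x, y]) v z) ->
  w t @[t --> 0^'-] --> xi0 -> derive1 w t @[t --> 0^'-] --> xi1 ->
  {in `]s, 0[, forall t, w t = xi0 + xi1 * t + fracint (1 + 1) v t}.
Proof.
move=> s0 intv dw incr w0 w1.
have dwE := fracint1_left_limit s0 intv incr w1.
pose q t := w t - (xi1 * t + fracint (1 + 1) v t).
have dq : {in `]s, 0[, forall t, is_derive t 1 q 0}.
  move=> t ts; have dwt : is_derive t 1 w (derive1 w t).
    by apply: (DeriveDef (dw _ ts)); rewrite -derive1E.
  have d2 := fracint2_derive s0 intv ts.
  have d1 : is_derive t 1 (fun y => xi1 * y) xi1.
    by apply: (is_derive_eq (is_deriveZ xi1 (is_derive_id t 1))); rewrite /GRing.scale/= mulr1.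
  apply: (is_derive_eq (is_deriveB dwt (is_deriveD d1 d2))).
  by rewrite dwE// subrr.
move=> t ts; have : q t = xi0.
  have c1 : q y @[y --> 0^'-] --> xi0.
    rewrite -[X in _ --> X]subr0; apply: cvgB => //.
    rewrite -[X in _ --> X]addr0; apply: cvgD; last exact: (fracint2_cvg0 s0 intv).
    apply: cvg_at_left_filter; rewrite -[X in _ --> X](mulr0 xi1); apply: cvgMr.
    exact: cvg_id.
  have c2 : q y @[y --> 0^'-] --> q t.
    apply: (@cvg_trans _ (cst (q t) @ 0^'-)); last exact: cvg_cst.
    apply: near_eq_cvg; near=> y; apply: (derive0_cst dq) => //.
    by rewrite in_itv/=; apply/andP; split; near: y; [exact: nbhs_left_gt|exact: nbhs_left_lt].
  exact: (cvg_unique _ c2 c1).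
by move=> <-; rewrite /q; ring.
Unshelve. all: by end_near. Qed.

(** I^2 v = I^1 (I^1 v) is differentiable everywhere because I^1 v is continuous, even though v is
    only integrable. *)
Lemma taylor2_converse s w v (xi0 xi1 : R) : s < 0 -> mu.-integrable `]s, 0[ (EFin \o v) ->
  {in `]s, 0[, forall t, w t = xi0 + xi1 * t + fracint (1 + 1) v t} ->
  [/\ {in `]s, 0[, forall t, is_derive t 1 w (xi1 - fracint 1 v t)},
      (forall x y, s < x -> x <= y -> y < 0 ->
         derive1 w y - derive1 w x = \int[mu]_(z in `[x, y]) v z),
      w t @[t --> 0^'-] --> xi0 & derive1 w t @[t --> 0^'-] --> xi1].
Proof.
move=> s0 intv wE.
have aux1 (a b c : R) : a - b - (a - c) = c - b by ring.
have dw t : t \in `]s, 0[ -> is_derive t 1 w (xi1 - fracint 1 v t).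
  move=> ts; have d2 := fracint2_derive s0 intv ts.
  have d1 : is_derive t 1 (fun y => xi1 * y) xi1.
    by apply: (is_derive_eq (is_deriveZ xi1 (is_derive_id t 1))); rewrite /GRing.scale/= mulr1.
  have d : is_derive t 1 (fun t => xi0 + xi1 * t + fracint (1 + 1) v t) (xi1 - fracint 1 v t).
    apply: (is_derive_eq (is_deriveD (is_deriveD (is_derive_cst xi0 t 1) d1) d2)).
    by rewrite add0r.
  apply: near_eq_is_derive d.
  by have := in_itv_oo_near ts; apply: filterS => x /wE ->.
have dwE t : t \in `]s, 0[ -> derive1 w t = xi1 - fracint 1 v t.
  by move=> /dw d; rewrite derive1E derive_val.
split => //.
- move=> x y sx xy y0; rewrite (Rintegral_fracint1 sx xy y0 intv) !dwE ?in_itv/=.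
  + exact: aux1.
  + by rewrite sx (le_lt_trans xy).
  + by rewrite y0 (lt_le_trans sx).
- have c : xi0 + xi1 * t + fracint (1 + 1) v t @[t --> 0^'-] --> xi0.
    rewrite -[X in _ --> X]addr0; apply: cvgD; last exact: (fracint2_cvg0 s0 intv).
    rewrite -[X in _ --> X]addr0; apply: cvgD; first exact: cvg_cst.
    apply: cvg_at_left_filter; rewrite -[X in _ --> X](mulr0 xi1); apply: cvgMr.
    exact: cvg_id.
  apply: cvg_trans c; apply: near_eq_cvg; near=> t; rewrite wE// in_itv/=.
  by apply/andP; split; near: t; [exact: nbhs_left_gt|exact: nbhs_left_lt].
- have c : xi1 - fracint 1 v t @[t --> 0^'-] --> xi1.
    rewrite -[X in _ --> X]subr0; apply: cvgB; first exact: cvg_cst.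
    exact: (fracint1_cvg0 s0 intv).
  apply: cvg_trans c; apply: near_eq_cvg; near=> t; rewrite dwE// in_itv/=.
  by apply/andP; split; near: t; [exact: nbhs_left_gt|exact: nbhs_left_lt].
Unshelve. all: by end_near. Qed.

(** Differentiate both sides: continuity makes - f and - g the derivatives at every point. *)
Lemma fracint1_inj s f g : s < 0 ->
  mu.-integrable `]s, 0[ (EFin \o f) -> mu.-integrable `]s, 0[ (EFin \o g) ->
  {in `]s, 0[, continuous f} -> {in `]s, 0[, continuous g} ->
  {in `]s, 0[, fracint 1 f =1 fracint 1 g} -> {in `]s, 0[, f =1 g}.
Proof.
move=> s0 intf intg cf cg fg t ts; apply: oppr_inj.
have df := fracint1_derive intf ts (cf _ ts).
have dg := fracint1_derive intg ts (cg _ ts).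
rewrite -(@derive_val _ _ _ _ _ _ _ df) -(@derive_val _ _ _ _ _ _ _ dg).
apply: near_eq_derive.
by have := in_itv_oo_near ts; apply: filterS => x /fg ->.
Qed.

End taylor.

Local Open Scope complex_scope.

Local Notation Re := complex.Re.
Local Notation Im := complex.Im.

(** * Complex-valued functions *)

Section complex_topology.
Variable R : realType.
Implicit Types z : R[i].

(** The norm of [R[i]] takes values in [R[i]]; a modulus in R can enter real estimates. *)
Definition cmod z : R := Num.sqrt (Re z ^+ 2 + Im z ^+ 2).

Lemma cmodE z : (cmod z)%:C = `|z|.
Proof. by rewrite normc_def. Qed.

Lemma cmod_ge0 z : 0 <= cmod z.
Proof. exact: sqrtr_ge0. Qed.

Lemma cmodX z n : cmod (z ^+ n) = cmod z ^+ n.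
Proof. by apply: complexI; rewrite cmodE normrX -cmodE rmorphXn. Qed.

Lemma cmod_Re z : `|Re z| <= cmod z.
Proof. by rewrite -sqrtr_sqr ler_wsqrtr// lerDl sqr_ge0. Qed.

Lemma cmod_Im z : `|Im z| <= cmod z.
Proof. by rewrite -sqrtr_sqr ler_wsqrtr// lerDr sqr_ge0. Qed.

Lemma cmod_le z : cmod z <= `|Re z| + `|Im z|.
Proof.
rewrite -[leRHS]ger0_norm ?addr_ge0// -sqrtr_sqr ler_wsqrtr//.
by rewrite sqrrD !real_normK ?num_real// addrAC lerDl mulrn_wge0// mulr_ge0.
Qed.

Lemma Re_add z1 z2 : Re (z1 + z2) = Re z1 + Re z2.
Proof. by case: z1; case: z2. Qed.

Lemma Im_add z1 z2 : Im (z1 + z2) = Im z1 + Im z2.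
Proof. by case: z1; case: z2. Qed.

Lemma Re_sub z1 z2 : Re (z1 - z2) = Re z1 - Re z2.
Proof. by case: z1; case: z2. Qed.

Lemma Im_sub z1 z2 : Im (z1 - z2) = Im z1 - Im z2.
Proof. by case: z1; case: z2. Qed.

Lemma Re_mul z1 z2 : Re (z1 * z2) = Re z1 * Re z2 - Im z1 * Im z2.
Proof. by case: z1; case: z2. Qed.

Lemma Im_mul z1 z2 : Im (z1 * z2) = Re z1 * Im z2 + Im z1 * Re z2.
Proof. by case: z1; case: z2. Qed.

Lemma Re_mulRl (x : R) z : Re (x%:C * z) = x * Re z.
Proof. by rewrite Re_mul /= mul0r subr0. Qed.

Lemma Im_mulRl (x : R) z : Im (x%:C * z) = x * Im z.
Proof. by rewrite Im_mul /= mul0r addr0. Qed.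

Lemma complex_eq z1 z2 : Re z1 = Re z2 -> Im z1 = Im z2 -> z1 = z2.
Proof. by case: z1 => a b; case: z2 => c d /= -> ->. Qed.

Lemma cvg_complexP (T : Type) (F : set_system T) (FF : Filter F) (f : T -> R[i]) (l : R[i]) :
  ((f x : R[i]^o) @[x --> F] --> (l : R[i]^o)) <->
  (Re (f x) @[x --> F] --> Re l) /\ (Im (f x) @[x --> F] --> Im l).
Proof.
split => [fl|[fr fi]].
  split; apply/cvgrPdist_lt => e e0;
    have e0' : 0 < (e%:C : R[i]) by rewrite ltcR.
    have /cvgrPdist_lt/(_ _ e0') := fl; apply: filterS => x.
    by rewrite -cmodE ltcR -Re_sub; apply: le_lt_trans; exact: cmod_Re.
  have /cvgrPdist_lt/(_ _ e0') := fl; apply: filterS => x.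
  by rewrite -cmodE ltcR -Im_sub; apply: le_lt_trans; exact: cmod_Im.
(* In the order of [R[i]], 0 < e says that e is real and positive. *)
apply/cvgrPdist_lt => e; rewrite ltcE /= => /andP[/eqP ei er].
have e2 : 0 < Re e / 2 by rewrite divr_gt0.
have /cvgrPdist_lt/(_ _ e2) nr := fr.
have /cvgrPdist_lt/(_ _ e2) ni := fi.
apply: filterS2 nr ni => x xr xi.
have -> : e = (Re e)%:C by apply: complex_eq.
rewrite -cmodE ltcR (le_lt_trans (cmod_le _))// Re_sub Im_sub (splitr (Re e)).
exact: ltrD.
Qed.

Lemma continuous_complexP (f : R -> R[i]) (t : R) :
  {for t, continuous (f : R -> R[i]^o)} <->
  {for t, continuous (fun x => Re (f x))} /\ {for t, continuous (fun x => Im (f x))}.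
Proof. exact: cvg_complexP. Qed.

Lemma continuous_complexD (f g : R -> R[i]) (t : R) :
  {for t, continuous (f : R -> R[i]^o)} -> {for t, continuous (g : R -> R[i]^o)} ->
  {for t, continuous (fun x => f x + g x : R[i]^o)}.
Proof.
move=> /continuous_complexP[fr fi] /continuous_complexP[gr gi].
apply/continuous_complexP; split; rewrite /prop_for /continuous_at.
  by rewrite Re_add; under eq_fun do rewrite Re_add; exact: cvgD.
by rewrite Im_add; under eq_fun do rewrite Im_add; exact: cvgD.
Qed.

Lemma continuous_complexZ (c : R[i]) (f : R -> R[i]) (t : R) :
  {for t, continuous (f : R -> R[i]^o)} ->
  {for t, continuous (fun x => c * f x : R[i]^o)}.
Proof.
move=> /continuous_complexP[fr fi].
apply/continuous_complexP; split; rewrite /prop_for /continuous_at.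
  rewrite Re_mul; under eq_fun do rewrite Re_mul.
  by apply: cvgB; exact: cvgMr.
rewrite Im_mul; under eq_fun do rewrite Im_mul.
by apply: cvgD; exact: cvgMr.
Qed.

Lemma within_continuous_complex (A : set R) (f : R -> R[i]) :
  {within A, continuous (f : R -> R[i]^o)} ->
  {within A, continuous (fun x => Re (f x))} /\ {within A, continuous (fun x => Im (f x))}.
Proof. by move=> cf; split => x; have /cvg_complexP[] := cf x. Qed.

Lemma normr_Re_mul z1 z2 B : `|Re z2| <= B -> `|Im z2| <= B ->
  `|Re (z1 * z2)| <= 2 * (cmod z1 * B).
Proof.
move=> hr hi; rewrite Re_mul (le_trans (ler_normB _ _))// !normrM mulr2n mulrDl !mul1r.
by apply: lerD; apply: ler_pM => //; [exact: cmod_Re|exact: cmod_Im].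
Qed.

Lemma normr_Im_mul z1 z2 B : `|Re z2| <= B -> `|Im z2| <= B ->
  `|Im (z1 * z2)| <= 2 * (cmod z1 * B).
Proof.
move=> hr hi; rewrite Im_mul (le_trans (ler_normD _ _))// !normrM mulr2n mulrDl !mul1r.
by apply: lerD; apply: ler_pM => //; [exact: cmod_Re|exact: cmod_Im].
Qed.

Lemma Re_sum (I : Type) (r : seq I) (F : I -> R[i]) :
  Re (\sum_(i <- r) F i) = \sum_(i <- r) Re (F i).
Proof. by elim/big_rec2: _ => // i y1 y2 _ <-; rewrite Re_add. Qed.

Lemma Im_sum (I : Type) (r : seq I) (F : I -> R[i]) :
  Im (\sum_(i <- r) F i) = \sum_(i <- r) Im (F i).
Proof. by elim/big_rec2: _ => // i y1 y2 _ <-; rewrite Im_add. Qed.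

End complex_topology.

Section cfracint.
Variable R : realType.
Notation mu := (@lebesgue_measure R).
Implicit Types (a b s t : R) (f g : R -> R[i]).

Definition cfracint a f t : R[i] :=
  fracint a (fun x => Re (f x)) t +i* fracint a (fun x => Im (f x)) t.

Definition cfrac_cv a f t : Prop :=
  frac_cv a (fun x => Re (f x)) t /\ frac_cv a (fun x => Im (f x)) t.

Lemma eq_cintegrable (D : set R) f g : measurable D -> (forall x, D x -> f x = g x) ->
  cintegrable D f -> cintegrable D g.
Proof.
move=> mD fg [r i]; split; [move: r|move: i]; apply: eq_integrable => // x /set_mem Dx;
  by rewrite fg.
Qed.

Lemma cintegrableD (D : set R) f g : measurable D -> cintegrable D f -> cintegrable D g ->
  cintegrable D (fun x => f x + g x).
Proof.
move=> mD [fr fi] [gr gi]; split.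
  by apply: eq_integrable (integrable_RD mD fr gr) => // x _ /=; rewrite Re_add.
by apply: eq_integrable (integrable_RD mD fi gi) => // x _ /=; rewrite Im_add.
Qed.

Lemma cintegrableZ (D : set R) c f : measurable D -> cintegrable D f ->
  cintegrable D (fun x => c * f x).
Proof.
move=> mD [fr fi]; split.
  apply: eq_integrable (integrable_RD mD (integrable_RZl (Re c) mD fr)
    (integrable_RZl (- Im c) mD fi)) => // x _ /=.
  by rewrite Re_mul mulNr.
apply: eq_integrable (integrable_RD mD (integrable_RZl (Re c) mD fi)
  (integrable_RZl (Im c) mD fr)) => // x _ /=.
by rewrite Im_mul.
Qed.

Lemma cintegrable_itvSr f s t : s <= t -> cintegrable `]s, 0[ f -> cintegrable `]t, 0[ f.
Proof. by move=> st [fr fi]; split; exact: integrable_itvSr st _. Qed.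

Lemma eq_cfracint a f g t : {in `]t, 0[, f =1 g} -> cfracint a f t = cfracint a g t.
Proof. by move=> fg; congr Complex; apply: eq_fracint => x xt; rewrite fg. Qed.

Lemma cfrac_cvD a f g t : cfrac_cv a f t -> cfrac_cv a g t ->
  cfrac_cv a (fun x => f x + g x) t.
Proof.
move=> [fr fi] [gr gi]; split.
  by apply: eq_frac_cv (frac_cvD fr gr) => x _; rewrite Re_add.
by apply: eq_frac_cv (frac_cvD fi gi) => x _; rewrite Im_add.
Qed.

Lemma cfracintD a f g t : cfrac_cv a f t -> cfrac_cv a g t ->
  cfracint a (fun x => f x + g x) t = cfracint a f t + cfracint a g t.
Proof.
move=> [fr fi] [gr gi]; apply: complex_eq; rewrite ?Re_add ?Im_add/= -fracintD//;
  by apply: eq_fracint => x _; rewrite ?Re_add ?Im_add.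
Qed.

Lemma cfrac_cvZ a c f t : cfrac_cv a f t -> cfrac_cv a (fun x => c * f x) t.
Proof.
move=> [fr fi]; split.
  apply: eq_frac_cv (frac_cvD (frac_cvZ (Re c) fr) (frac_cvZ (- Im c) fi)) => x _.
  by rewrite Re_mul mulNr.
apply: eq_frac_cv (frac_cvD (frac_cvZ (Re c) fi) (frac_cvZ (Im c) fr)) => x _.
by rewrite Im_mul.
Qed.

Lemma cfracintZ a c f t : cfrac_cv a f t ->
  cfracint a (fun x => c * f x) t = c * cfracint a f t.
Proof.
move=> [fr fi]; apply: complex_eq; rewrite ?Re_mul ?Im_mul/=.
  rewrite -mulNr -!fracintZ// -fracintD; [|exact: frac_cvZ..].
  by apply: eq_fracint => x _; rewrite Re_mul mulNr.
rewrite -!fracintZ// -fracintD; [|exact: frac_cvZ..].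
by apply: eq_fracint => x _; rewrite Im_mul.
Qed.

Lemma cfracint_semigroup a b f t : 0 < a -> 0 < b -> cintegrable `]t, 0[ f ->
  cfrac_cv (a + b) f t ->
  cfrac_cv a (cfracint b f) t /\ cfracint a (cfracint b f) t = cfracint (a + b) f t.
Proof.
move=> a0 b0 [/integrable_EFin_measurable mr /integrable_EFin_measurable mi] [fr fi].
have [cr er] := fracint_semigroup a0 b0 mr fr.
have [ci ei] := fracint_semigroup a0 b0 mi fi.
by split => //; exact: complex_eq.
Qed.

Lemma cfrac_cv_ge1 a f t : 1 <= a -> cintegrable `]t, 0[ f -> cfrac_cv a f t.
Proof. by move=> a1 [fr fi]; split; exact: frac_cv_ge1. Qed.

Lemma cfracint_semigroup_ge1 a b f t : 0 < a -> 0 < b -> 1 <= a + b -> cintegrable `]t, 0[ f ->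
  cfracint a (cfracint b f) t = cfracint (a + b) f t.
Proof.
move=> a0 b0 ab1 intf.
by have [_ ->] := cfracint_semigroup a0 b0 intf (cfrac_cv_ge1 ab1 intf).
Qed.

Lemma cfracint_integrable a f s : 0 < a -> cintegrable `]s, 0[ f ->
  cintegrable `]s, 0[ (cfracint a f).
Proof. by move=> a0 [fr fi]; split; exact: fracint_integrable. Qed.

Lemma fracint0 a t : fracint a (fun=> 0) t = 0 :> R.
Proof.
rewrite /fracint /Rintegral (_ : (fun x => _) = cst 0%E) ?integral0//.
by apply/funext => x; rewrite mulr0.
Qed.

Lemma frac_cv0 a t : @frac_cv R a (fun=> 0) t.
Proof.
rewrite /frac_cv (_ : (fun x => _) = cst 0%E); [exact: integrable0|].
by apply/funext => x; rewrite mulr0.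
Qed.

Lemma cfracint_kern a b t : 0 < a -> 0 < b ->
  cfrac_cv b (fun x => (kern a (- x))%:C) t /\
  cfracint b (fun x => (kern a (- x))%:C) t = (kern (b + a) (- t))%:C.
Proof.
move=> a0 b0; have [cv e] := fracint_kern t a0 b0.
split; first by split => //; exact: frac_cv0.
by apply: complex_eq => //=; rewrite fracint0.
Qed.

(** The Taylor polynomial with remainder, the right-hand side of the Volterra equation and its
    derivative of order nu all have this shape: two kernels plus a remainder. Fractional integration
    raises each order by a. *)
Lemma cfracint_kernD (x0 x1 a b0 b1 : R) f t : 0 < a -> 0 < b0 -> 0 < b1 -> cfrac_cv a f t ->
  let F x := x0%:C * (kern b0 (- x))%:C - x1%:C * (kern b1 (- x))%:C + f x in
  cfrac_cv a F t /\
  cfracint a F t = x0%:C * (kern (a + b0) (- t))%:C - x1%:C * (kern (a + b1) (- t))%:C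
    + cfracint a f t.
Proof.
move=> a0 b00 b10 cf F.
have [c0 e0] := cfracint_kern t b00 a0; have [c1 e1] := cfracint_kern t b10 a0.
have FE : F = (fun x => x0%:C * (kern b0 (- x))%:C + - x1%:C * (kern b1 (- x))%:C + f x).
  by apply/funext => x; rewrite mulNr.
have c01 := cfrac_cvD (cfrac_cvZ x0%:C c0) (cfrac_cvZ (- x1%:C) c1).
rewrite FE; split; first exact: cfrac_cvD.
by rewrite cfracintD// cfracintD ?cfracintZ ?e0 ?e1 ?mulNr//; exact: cfrac_cvZ.
Qed.

Lemma cintegrable_kern a s : 0 < a -> cintegrable `]s, 0[ (fun x => (kern a (- x))%:C).
Proof.
move=> a0; split; last exact: integrable0.
by apply/frac_cv1; have [] := fracint_kern s a0 ltr01.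
Qed.

Lemma cfracint1_continuous f s : s < 0 -> cintegrable `]s, 0[ f ->
  {in `]s, 0[, continuous (cfracint 1 f : R -> R[i]^o)}.
Proof.
move=> s0 [fr fi] t ts; apply/continuous_complexP; split.
  exact: (fracint1_continuous s0 fr ts).
exact: (fracint1_continuous s0 fi ts).
Qed.

(** For a > 1, I^a f = I^1 (I^(a-1) f), and I^1 of an integrable function is continuous. *)
Lemma cfracint_continuous a f s : s < 0 -> 1 < a -> cintegrable `]s, 0[ f ->
  {in `]s, 0[, continuous (cfracint a f : R -> R[i]^o)}.
Proof.
move=> s0 a1 intf t ts; have a0 : 0 < a - 1 by rewrite subr_gt0.
have := cfracint1_continuous s0 (cfracint_integrable a0 intf) ts.
have E x : x \in `]s, 0[ -> cfracint 1 (cfracint (a - 1) f) x = cfracint a f x.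
  rewrite in_itv/= => /andP[sx _].
  rewrite cfracint_semigroup_ge1// ?subrKC ?(ltW a1)//; exact: cintegrable_itvSr (ltW sx) intf.
rewrite /prop_for /continuous_at E//; apply: cvg_trans; apply: near_eq_cvg.
by have := in_itv_oo_near ts; apply: filterS => x /E.
Qed.

Lemma cfracint1_inj s f g : s < 0 ->
  cintegrable `]s, 0[ f -> cintegrable `]s, 0[ g ->
  {in `]s, 0[, continuous (f : R -> R[i]^o)} -> {in `]s, 0[, continuous (g : R -> R[i]^o)} ->
  {in `]s, 0[, cfracint 1 f =1 cfracint 1 g} -> {in `]s, 0[, f =1 g}.
Proof.
move=> s0 [fr fi] [gr gi] cf cg fg t ts.
apply: complex_eq.
  apply: (fracint1_inj s0 fr gr) ts => x xs.
  - by have /continuous_complexP[] := cf _ xs.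
  - by have /continuous_complexP[] := cg _ xs.
  - by have [] := fg _ xs.
apply: (fracint1_inj s0 fi gi) ts => x xs.
- by have /continuous_complexP[] := cf _ xs.
- by have /continuous_complexP[] := cg _ xs.
- by have [] := fg _ xs.
Qed.

(** The equality holds at divergent points as well: moving the positive factor 1 / Gamma(a) into the
    integral respects the default value 0. *)
Lemma RL_integralE a f t : 0 < a -> cintegrable `]t, 0[ f ->
  RL_integral a f t = cfracint a f t.
Proof.
move=> a0 [/integrable_EFin_measurable mr /integrable_EFin_measurable mi].
rewrite /RL_integral gt_eqF//.
have E (h : R -> R) : measurable_fun `]t, 0[ h ->
    (Gamma a)^-1 * \int[mu]_(x in `]t, 0[) ((x - t) `^ (a - 1) * h x) = fracint a h t.
  move=> mh; rewrite -gt0_RintegralZl ?invr_gt0 ?Gamma_gt0//; last first.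
    apply: measurable_funM => //; apply: measurable_funTS.
    by apply: (measurableT_comp (measurable_powR (a - 1))); exact: measurable_funB.
  apply: eq_Rintegral => x; rewrite inE/= in_itv/= => /andP[tx _].
  by rewrite kern_gt0 ?subr_gt0// mulrCA mulrA.
apply: complex_eq; rewrite ?Re_mulRl ?Im_mulRl/= -E//; congr (_ * _);
  by apply: eq_Rintegral => x _; rewrite /RL_kernel ?Re_mulRl ?Im_mulRl.
Qed.

Lemma RL_convergentP a f t : 0 < a -> RL_convergent a f t <-> cfrac_cv a f t.
Proof.
move=> a0; have g0 := Gamma_gt0 a0.
have E (h : R -> R) :
    mu.-integrable `]t, 0[ (EFin \o (fun x => (x - t) `^ (a - 1) * h x)) <->
    frac_cv a h t.
  split.
    move=> /(integrable_RZl (Gamma a)^-1 (measurable_itv _)).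
    apply: eq_integrable => // x; rewrite inE/= in_itv/= => /andP[tx _].
    by rewrite kern_gt0 ?subr_gt0// mulrCA mulrA.
  move=> /(integrable_RZl (Gamma a) (measurable_itv _)).
  apply: eq_integrable => // x; rewrite inE/= in_itv/= => /andP[tx _].
  by rewrite kern_gt0 ?subr_gt0//; congr EFin; field; rewrite gt_eqF.
split.
  move=> /(_ (lt0r_neq0 a0))[r i]; split; apply/E.
    by apply: eq_integrable r => // x _; rewrite /RL_kernel Re_mulRl.
  by apply: eq_integrable i => // x _; rewrite /RL_kernel Im_mulRl.
move=> [/E r /E i] _; split.
  by apply: eq_integrable r => // x _; rewrite /RL_kernel Re_mulRl.
by apply: eq_integrable i => // x _; rewrite /RL_kernel Im_mulRl.
Qed.

End cfracint.

(** * The Volterra equation and the Mittag-Leffler functions *)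

Section geometric.
Variable R : realType.

Lemma sum_geometric_half n : \sum_(0 <= k < n) (2^-1 : R) ^+ k <= 2.
Proof.
have h : \sum_(0 <= k < n) (2^-1 : R) ^+ k = 2 - 2 * 2^-1 ^+ n.
  elim: n => [|n IH]; first by rewrite big_nil expr0 mulr1 subrr.
  by rewrite big_nat_recr//= IH exprS; field.
by rewrite h gerBl mulr_ge0// exprn_ge0// invr_ge0.
Qed.

Lemma le_sum_geometric (a : nat -> R) B : 0 <= B ->
  (forall k, `|a k| <= B * 2^-1 ^+ k) -> forall n, `|\sum_(0 <= k < n) a k| <= 2 * B.
Proof.
move=> B0 aB n; rewrite (le_trans (ler_norm_sum _ _ _))//.
rewrite (le_trans (ler_sum _ (fun k _ => aB k)))// -mulr_sumr mulrC ler_wpM2r//.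
exact: sum_geometric_half.
Qed.

Lemma cvg_geometric_half (B : R) : B * 2^-1 ^+ n @[n --> \oo] --> 0.
Proof. by apply: cvg_geometric; rewrite ger0_norm ?invr_ge0// invf_lt1// ltr1n. Qed.

Lemma is_cvg_series_geometric_le (a : nat -> R) B :
  (forall k, `|a k| <= B * 2^-1 ^+ k) -> cvgn (series a).
Proof.
move=> aB; apply: normed_cvg; apply: (@series_le_cvg _ _ (geometric B 2^-1)) => //.
- by move=> n /=.
- by move=> n /=; exact: le_trans (aB n).
- by apply: is_cvg_geometric_series; rewrite ger0_norm ?invr_ge0// invf_lt1// ltr1n.
Qed.

End geometric.

(** * Termwise bounds for the Mittag-Leffler series *)

Section mittag_leffler_kernel.
Variable R : realType.
Notation mu := (@lebesgue_measure R).
Variables (delta : R) (lambda : R[i]).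
Hypothesis delta1 : 1 <= delta.

Definition ml_kern (b s : R) : R[i] :=
  (s `^ (b - 1))%:C * mittag_leffler delta b (lambda * (s `^ delta)%:C).

(** The k-th term of the series for [ml_kern], with s^(b-1) multiplied in: a multiple of a kernel,
    on which fractional integration acts by a shift of the order. *)
Definition ml_term (b s : R) (k : nat) : R[i] :=
  lambda ^+ k * (kern (delta * k%:R + b) s)%:C.

Lemma delta_natD_ge0 k : 0 <= delta * k%:R.
Proof. by rewrite mulr_ge0// (le_trans ler01). Qed.

(** Put x = delta k + b. For k >= 1 the kernel is at most its value at T, and [Gamma_ge] bounds that
    by e^(N+1) (T/N)^(x-1), where T/N = 1/q. As x >= k, the k-th term is at most C (|lambda|/q)^k.
    The term k = 0 is [kern b s] itself, unbounded near 0 if b < 1, hence its place in the bound. *)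
Lemma kern_geometric b T : 0 < b -> 0 < T -> exists2 C, 0 <= C &
  forall k s, 0 < s -> s <= T ->
    cmod lambda ^+ k * kern (delta * k%:R + b) s <= (C + kern b s) * 2^-1 ^+ k.
Proof.
move=> b0 T0; set L := cmod lambda; have L0 : 0 <= L by exact: cmod_ge0.
have d0 : 0 < delta by rewrite (lt_le_trans ltr01).
(* The factor 2 gives |lambda| / q <= 1/2; the summand 1 gives q >= 1, so that powers of 1/q
   decrease in the exponent. *)
pose q := 2 * (L + 1); have q0 : 0 < q by rewrite mulr_gt0// ltr_wpDl.
have q1 : 1 <= q by rewrite /q mulrDr mulr1 ler_wpDl ?mulr_ge0// ler1n.
(* With this N, cmod lambda * (T / N) `^ delta <= 1 / 2. *)
pose N := T * q; have N0 : 0 < N by rewrite mulr_gt0.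
(* The factor q pays for the exponent x - 1, which is only known to be at least k - 1 for the k-th
   term. *)
pose C := expR (N + 1) * q.
have C0 : 0 <= C by rewrite mulr_ge0 ?expR_ge0// ltW.
exists C => // k s s0 sT; case: k => [|k].
  by rewrite !expr0 mul1r mulr1 mulr0 add0r ler_wpDl.
set x := delta * k.+1%:R + b.
have kx : k.+1%:R <= x.
  by rewrite ler_wpDr ?(ltW b0)// -[leLHS]mul1r ler_wpM2r.
have x1 : 1 <= x by rewrite (le_trans _ kx)// ler1n.
have x0 : 0 < x by rewrite (lt_le_trans ltr01).
have kq : q^-1 `^ (x - 1) <= q * q^-1 ^+ k.+1.
  rewrite exprS mulrA divff ?gt_eqF// mul1r -powR_mulrn ?invr_ge0 ?(ltW q0)//.
  rewrite ger_powR ?invr_gt0 ?q0 ?invf_le1//.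
  by rewrite lerBrDr natr1.
apply: (@le_trans _ _ (L ^+ k.+1 * (C * q^-1 ^+ k.+1))).
  rewrite ler_wpM2l ?exprn_ge0// (le_trans (le_kern x1 sT))// kern_gt0//.
  rewrite ler_pdivrMr ?Gamma_gt0//.
  apply: le_trans (ler_wpM2l _ (Gamma_ge x1 N0)); last first.
    by rewrite mulr_ge0// exprn_ge0// invr_ge0 ltW.
  have qx : 0 < q `^ (x - 1) by rewrite powR_gt0.
  have qV : q^-1 `^ (x - 1) = (q `^ (x - 1))^-1.
    by rewrite -powR_inv1 ?(ltW q0)// -powRrM mulN1r powRN.
  have -> : C * q^-1 ^+ k.+1 * (N `^ (x - 1) * expR (- (N + 1))) =
      T `^ (x - 1) * ((q * q^-1 ^+ k.+1) * q `^ (x - 1)).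
    have e0 := expR_gt0 (N + 1).
    rewrite /C expRN {2}/N powRM ?(ltW T0) ?(ltW q0)//.
    set e := expR _ in e0 *; set y := _ ^+ k.+1; set p := T `^ _; set r := q `^ _.
    by field; rewrite gt_eqF.
  rewrite ler_peMr ?powR_ge0//.
  by rewrite -(ler_pdivrMr _ _ qx) mul1r -qV.
rewrite mulrCA -exprMn.
apply: ler_pM => //.
- by rewrite exprn_ge0// mulr_ge0// invr_ge0 ltW.
- by rewrite lerDl kern_ge0.
- apply: lerXn2r; rewrite ?nnegrE ?mulr_ge0 ?invr_ge0 ?(ltW q0)//.
  by rewrite ler_pdivrMr// /q mulKf// lerDl.
Qed.

Lemma ml_term_Re_le b T : 0 < b -> 0 < T -> exists2 C, 0 <= C &
  forall k s, 0 < s -> s <= T ->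
    `|Re (ml_term b s k)| <= (C + kern b s) * 2^-1 ^+ k /\
    `|Im (ml_term b s k)| <= (C + kern b s) * 2^-1 ^+ k.
Proof.
move=> b0 T0; have [C C0 H] := kern_geometric b0 T0; exists C => // k s s0 sT.
have x0 : 0 < delta * k%:R + b by rewrite ltr_wpDl ?delta_natD_ge0.
have := H k s s0 sT; rewrite /ml_term [_ * _%:C]mulrC Re_mulRl Im_mulRl.
rewrite (normrM (kern _ _) (Re _)) (normrM (kern _ _) (Im _)).
rewrite (ger0_norm (kern_ge0 _ x0)) -cmodX mulrC => h.
split; apply: le_trans h; rewrite ler_wpM2l ?kern_ge0//; first exact: cmod_Re.
exact: cmod_Im.
Qed.

Lemma ml_termE b s k : 0 < s -> ml_term b s k =
  (s `^ (b - 1))%:C * ((lambda * (s `^ delta)%:C) ^+ k / (Gamma (delta * k%:R + b))%:C).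
Proof.
move=> s0; rewrite /ml_term kern_gt0// exprMn.
have -> : s `^ (delta * k%:R + b - 1) = s `^ (b - 1) * (s `^ delta) ^+ k.
  rewrite -powR_mulrn ?powR_ge0// -powRrM -powRD ?(gt_eqF s0) ?implybT//.
  by congr (_ `^ _); ring.
have aux (l p q g : R[i]) : l * (p * q * g) = p * (l * q * g) by ring.
have rM (x y : R) : (x * y)%:C = x%:C * y%:C by exact: rmorphM.
have rX (x : R) n : (x ^+ n)%:C = x%:C ^+ n by exact: rmorphXn.
have rV (x : R) : (x^-1)%:C = x%:C^-1 by exact: fmorphV.
by rewrite (rM _ (Gamma _)^-1) (rM (s `^ _) _) rX rV aux.
Qed.

(** [mittag_leffler] is defined as a [limn], whose value can be used only once convergence is
    proved. The series of real and imaginary parts converge by domination, and division by s^(b-1) >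
    0 returns to the defining series. *)
Lemma ml_series_cvg b s : 0 < b -> 0 < s ->
  Re (series (ml_term b s) n) @[n --> \oo] --> Re (ml_kern b s) /\
  Im (series (ml_term b s) n) @[n --> \oo] --> Im (ml_kern b s).
Proof.
move=> b0 s0; have [C C0 H] := ml_term_Re_le b0 s0.
have cr : cvgn (series (fun k => Re (ml_term b s k))).
  by apply: (@is_cvg_series_geometric_le _ _ (C + kern b s)) => k; have [] := H k s s0 (lexx _).
have ci : cvgn (series (fun k => Im (ml_term b s k))).
  by apply: (@is_cvg_series_geometric_le _ _ (C + kern b s)) => k; have [] := H k s s0 (lexx _).
set lr := limn _ in cr; set li := limn _ in ci.
pose a k := (lambda * (s `^ delta)%:C) ^+ k / (Gamma (delta * k%:R + b))%:C.
have p0 : 0 < s `^ (b - 1) by rewrite powR_gt0.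
have aE k : a k = ((s `^ (b - 1))^-1)%:C * ml_term b s k.
  by rewrite ml_termE// mulrA -rmorphM mulVf ?mul1r// gt_eqF.
have saE n : series a n = ((s `^ (b - 1))^-1)%:C * series (ml_term b s) n.
  by rewrite /series/= mulr_sumr; apply: eq_bigr.
have c : (series a n : R[i]^o) @[n --> \oo] --> (((s `^ (b - 1))^-1)%:C * (lr +i* li) : R[i]^o).
  apply/cvg_complexP; rewrite Re_mulRl Im_mulRl/=; split.
    rewrite (_ : (fun n => _) =
        (fun n => (s `^ (b - 1))^-1 * series (fun k => Re (ml_term b s k)) n)).
      exact: cvgMr.
    by apply/funext => n; rewrite saE Re_mulRl /series/= Re_sum.
  rewrite (_ : (fun n => _) =
        (fun n => (s `^ (b - 1))^-1 * series (fun k => Im (ml_term b s k)) n)).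
    exact: cvgMr.
  by apply/funext => n; rewrite saE Im_mulRl /series/= Im_sum.
have -> : ml_kern b s = lr +i* li.
  have e : mittag_leffler delta b (lambda * (s `^ delta)%:C) = ((s `^ (b - 1))^-1)%:C * (lr +i* li).
    exact: (cvg_lim (@norm_hausdorff _ _) c).
  by rewrite /ml_kern e mulrA -rmorphM divff ?mul1r// gt_eqF.
split.
  by rewrite (_ : (fun n => _) = series (fun k => Re (ml_term b s k)))//;
    apply/funext => n; exact: Re_sum.
by rewrite (_ : (fun n => _) = series (fun k => Im (ml_term b s k)))//;
    apply/funext => n; exact: Im_sum.
Qed.

Lemma ml_series_le b T : 0 < b -> 0 < T -> exists2 C, 0 <= C &
  forall n s, 0 < s -> s <= T ->
    `|Re (series (ml_term b s) n)| <= 2 * (C + kern b s) /\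
    `|Im (series (ml_term b s) n)| <= 2 * (C + kern b s).
Proof.
move=> b0 T0; have [C C0 H] := ml_term_Re_le b0 T0; exists C => // n s s0 sT.
rewrite /series/= Re_sum Im_sum.
have B0 : 0 <= C + kern b s by rewrite addr_ge0// kern_ge0.
by split; apply: le_sum_geometric => // k; have [] := H k s s0 sT.
Qed.

End mittag_leffler_kernel.

Section dominated.
Variable R : realType.
Notation mu := (@lebesgue_measure R).

Lemma dominated_Rintegral (D : set R) (f_ : nat -> R -> R) (f g : R -> R) : measurable D ->
  (forall n, measurable_fun D (f_ n)) ->
  (forall x, D x -> f_ n x @[n --> \oo] --> f x) ->
  mu.-integrable D (EFin \o g) ->
  (forall n x, D x -> `|f_ n x| <= g x) ->
  mu.-integrable D (EFin \o f) /\
  \int[mu]_(x in D) f_ n x @[n --> \oo] --> \int[mu]_(x in D) f x.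
Proof.
move=> mD mf_ cf ig fg.
have mf : measurable_fun D f by apply: (measurable_fun_cvg mf_).
have := @dominated_convergence _ _ R mu D mD (fun n => EFin \o f_ n) (EFin \o f) (EFin \o g).
case => //.
- by move=> n; apply/measurable_EFinP; exact: mf_.
- by apply/measurable_EFinP.
- by apply: aeW => x Dx; apply: cvg_EFin; [exact: nearW|exact: cf].
- by apply: aeW => x n Dx; exact: fg.
move=> intf _ c.
split=> //.
apply: fine_cvg; rewrite fineK//.
exact: integrable_fin_num.
Qed.

End dominated.

(** * The Neumann series of the Volterra equation *)

Section volterra.
Variable R : realType.
Notation mu := (@lebesgue_measure R).
Variables (s delta : R) (lambda : R[i]).
Hypotheses (s0 : s < 0) (delta1 : 1 <= delta).

Let delta0 : 0 < delta. Proof. by rewrite (lt_le_trans ltr01). Qed.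
Let Ns0 : 0 < - s. Proof. by rewrite oppr_gt0. Qed.

Let itvW t x : t \in `]s, 0[ -> x \in `]t, 0[ -> x \in `]s, 0[.
Proof. by rewrite !in_itv/= => /andP[st _] /andP[tx ->]; rewrite (lt_trans st tx). Qed.

Let itv_le t : t \in `]s, 0[ -> s <= t.
Proof. by rewrite in_itv/= => /andP[/ltW]. Qed.

(** All orders here are at least 1, so the kernels are largest at - s and the bound is uniform in t,
    with no singular term. *)
Lemma cfracint_geometric f : cintegrable `]s, 0[ f -> exists2 B, 0 <= B &
  forall k t, t \in `]s, 0[ ->
    `|Re (lambda ^+ k * cfracint (delta * k%:R + delta) f t)| <= B * 2^-1 ^+ k /\
    `|Im (lambda ^+ k * cfracint (delta * k%:R + delta) f t)| <= B * 2^-1 ^+ k.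
Proof.
move=> [fr fi]; have [C C0 H] := kern_geometric lambda delta1 delta0 Ns0.
pose G := \int[mu]_(x in `]s, 0[) `|Re (f x)| + \int[mu]_(x in `]s, 0[) `|Im (f x)|.
have Gr0 : 0 <= \int[mu]_(x in `]s, 0[) `|Re (f x)| by exact: Rintegral_ge0.
have Gi0 : 0 <= \int[mu]_(x in `]s, 0[) `|Im (f x)| by exact: Rintegral_ge0.
have G0 : 0 <= G by exact: addr_ge0.
have K0 : 0 <= C + kern delta (- s) by rewrite addr_ge0// kern_ge0.
exists (2 * (C + kern delta (- s)) * G); first by rewrite !mulr_ge0.
move=> k t ts; have st := itv_le ts.
have a1 : 1 <= delta * k%:R + delta by rewrite ler_wpDl ?delta_natD_ge0.
have kG : cmod lambda ^+ k * (kern (delta * k%:R + delta) (- s) * G) <=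
    (C + kern delta (- s)) * G * 2^-1 ^+ k.
  by rewrite mulrA [leRHS]mulrAC ler_wpM2r// H.
have br : `|Re (cfracint (delta * k%:R + delta) f t)| <= kern (delta * k%:R + delta) (- s) * G.
  apply: le_trans (fracint_le a1 st fr) _; rewrite ler_wpM2l ?kern_ge0 ?lerDl//.
  exact: lt_le_trans a1.
have bi : `|Im (cfracint (delta * k%:R + delta) f t)| <= kern (delta * k%:R + delta) (- s) * G.
  apply: le_trans (fracint_le a1 st fi) _; rewrite ler_wpM2l ?kern_ge0 ?lerDr//.
  exact: lt_le_trans a1.
rewrite -!mulrA; split.
  apply: le_trans (normr_Re_mul _ br bi) _; rewrite ler_wpM2l// cmodX mulrA.
  by rewrite mulrA in kG; rewrite !mulrA in kG *.
apply: le_trans (normr_Im_mul _ br bi) _; rewrite ler_wpM2l// cmodX mulrA.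
by rewrite mulrA in kG; rewrite !mulrA in kG *.
Qed.

Variables (E : nat -> R -> R[i]) (dom : R -> R).
Hypothesis intE : forall k, cintegrable `]s, 0[ (E k).
Hypothesis ES : forall k, {in `]s, 0[, cfracint delta (E k) =1 E k.+1}.

(** Partial sums of the Neumann series: by [ES], [E k] is the k-fold integral of order delta of
    [E 0], the inhomogeneous term. *)
Let F n t : R[i] := \sum_(0 <= k < n) lambda ^+ k * E k t.

Let intF n : cintegrable `]s, 0[ (F n).
Proof.
elim: n => [|n IH].
  apply: (@eq_cintegrable _ _ (fun=> 0)) => //; first by move=> x _; rewrite /F big_nil.
  by split; exact: integrable0.
apply: (@eq_cintegrable _ _ (fun t => F n t + lambda ^+ n * E n t)) => //.
  by move=> x _; rewrite /F big_nat_recr.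
by apply: cintegrableD => //; exact: cintegrableZ.
Qed.

Let cvD f t : t \in `]s, 0[ -> cintegrable `]s, 0[ f -> cfrac_cv delta f t.
Proof. by move=> /itv_le st intf; apply: cfrac_cv_ge1 => //; exact: cintegrable_itvSr intf. Qed.

(** One Picard step applied to [F n] gives [F n.+1]. *)
Let FS n t : t \in `]s, 0[ -> F n.+1 t = E 0 t + lambda * cfracint delta (F n) t.
Proof.
move=> ts; rewrite /F big_nat_recl// expr0 mul1r; congr (_ + _).
elim: n => [|n IH].
  rewrite big_nil (@eq_cfracint _ _ _ (fun=> 0) _) ?mulr0//; last by move=> x _; rewrite big_nil.
  by rewrite (_ : cfracint _ _ _ = 0) ?mulr0//; apply: complex_eq; exact: fracint0.
rewrite big_nat_recr//= IH.
rewrite (@eq_cfracint _ _ (F n.+1) (fun t => F n t + lambda ^+ n * E n t) _); last first.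
  by move=> x _; rewrite /F big_nat_recr.
rewrite cfracintD ?cfracintZ; [|exact: cvD..|].
  by rewrite ES// mulrDr exprS mulrA.
exact/cfrac_cvZ/cvD.
Qed.

(** The remainder after n steps is lambda^n times the n-fold integral of u, and it decays
    geometrically for any integrable solution u; hence every solution is the limit of the same
    sums. *)
Lemma volterra_unique u : cintegrable `]s, 0[ u ->
  {in `]s, 0[, forall t, u t = E 0 t + lambda * cfracint delta u t} ->
  {in `]s, 0[, forall t, (F n t : R[i]^o) @[n --> \oo] --> (u t : R[i]^o)}.
Proof.
move=> intu uE.
(* W n = I^(n delta) u, and u = F n + lambda^n W n. *)
pose W n := iter n (cfracint delta) u.
have intW n : cintegrable `]s, 0[ (W n).
  by elim: n => // n IH; exact: cfracint_integrable.
have WE n t : t \in `]s, 0[ -> W n t = E n t + lambda * W n.+1 t.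
  elim: n t => [t ts|n IH t ts]; first exact: uE.
  rewrite [LHS](@eq_cfracint _ _ (W n) (fun t => E n t + lambda * W n.+1 t) _); last first.
    by move=> x xt; rewrite IH// (itvW ts).
  by rewrite cfracintD ?cfracintZ ?ES//; [exact: cvD..|exact/cfrac_cvZ/cvD].
have uF n t : t \in `]s, 0[ -> u t = F n t + lambda ^+ n * W n t.
  move=> ts; elim: n => [|n IH]; first by rewrite /F big_nil expr0 mul1r add0r.
  by rewrite /F big_nat_recr//= IH WE// mulrDr mulrA exprSr addrA.
(* The formula starts at [W 1], because [cfracint 0] is not the identity; this is why the limit is
   first taken along [F n.+1]. *)
have WS n t : t \in `]s, 0[ -> W n.+1 t = cfracint (delta * n%:R + delta) u t.
  elim: n t => [t ts|n IH t ts]; first by rewrite mulr0 add0r.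
  rewrite [LHS](@eq_cfracint _ _ (W n.+1) (cfracint (delta * n%:R + delta) u) _); last first.
    by move=> x xt; rewrite IH// (itvW ts).
  have d0 : 0 < delta * n%:R + delta by rewrite ltr_wpDl ?delta_natD_ge0.
  rewrite cfracint_semigroup_ge1//.
  - by congr (cfracint _ u t); rewrite -natr1; ring.
  - by rewrite ler_wpDr// ltW.
  - exact: cintegrable_itvSr (itv_le ts) intu.
move=> t ts; have [B B0 H] := cfracint_geometric intu.
have remE n : u t - F n.+1 t = lambda * (lambda ^+ n * cfracint (delta * n%:R + delta) u t).
  by rewrite (uF n.+1 t ts) addrC addKr WS// exprS mulrA.
have [cr ci] : (Re (u t - F n.+1 t) @[n --> \oo] --> 0) /\ (Im (u t - F n.+1 t) @[n --> \oo] --> 0).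
  have cB := cvg_geometric_half (2 * (cmod lambda * B)).
  have NcB : - (2 * (cmod lambda * B) * 2^-1 ^+ n) @[n --> \oo] --> 0.
    by rewrite -[X in _ --> X]oppr0; exact: cvgN.
  split; apply: (squeeze_cvgr _ NcB cB); apply: nearW => n; rewrite -ler_norml remE.
    have [hr hi] := H n t ts.
    by apply: le_trans (normr_Re_mul _ hr hi) _; rewrite !mulrA.
  have [hr hi] := H n t ts.
  by apply: le_trans (normr_Im_mul _ hr hi) _; rewrite !mulrA.
suff: (F n.+1 t : R[i]^o) @[n --> \oo] --> (u t : R[i]^o).
  by rewrite (cvg_shiftS (fun n => F n t : R[i]^o)).
apply/cvg_complexP; split.
  rewrite (_ : (fun n => _) = (fun n => Re (u t) - Re (u t - F n.+1 t))).
    by rewrite -[X in _ --> X]subr0; apply: cvgB => //; exact: cvg_cst.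
  by apply/funext => n /=; rewrite Re_sub opprB addrC subrK.
rewrite (_ : (fun n => _) = (fun n => Im (u t) - Im (u t - F n.+1 t))).
  by rewrite -[X in _ --> X]subr0; apply: cvgB => //; exact: cvg_cst.
by apply/funext => n /=; rewrite Im_sub opprB addrC subrK.
Qed.

Hypothesis intdom : mu.-integrable `]s, 0[ (EFin \o dom).
Hypothesis Edom : forall k t, t \in `]s, 0[ ->
  `|Re (lambda ^+ k * E k t)| <= dom t * 2^-1 ^+ k /\
  `|Im (lambda ^+ k * E k t)| <= dom t * 2^-1 ^+ k.

(** Pass to the limit in [FS]. The partial sums are bounded by 2 [dom], and for delta >= 1 the
    kernel is bounded by [kern delta (- s)], so dominated convergence applies under the integral. *)
Lemma volterra_exists u :
  {in `]s, 0[, forall t, (F n t : R[i]^o) @[n --> \oo] --> (u t : R[i]^o)} ->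
  cintegrable `]s, 0[ u /\
  {in `]s, 0[, forall t, u t = E 0 t + lambda * cfracint delta u t}.
Proof.
move=> Fu.
have dom0 t : t \in `]s, 0[ -> 0 <= dom t.
  by move=> ts; have [+ _] := Edom 0 ts; rewrite expr0 mulr1; exact: le_trans.
have Fr n t : t \in `]s, 0[ -> `|Re (F n t)| <= 2 * dom t.
  move=> ts; rewrite /F Re_sum; apply: le_sum_geometric; first exact: dom0.
  by move=> k; have [] := Edom k ts.
have Fi n t : t \in `]s, 0[ -> `|Im (F n t)| <= 2 * dom t.
  move=> ts; rewrite /F Im_sum; apply: le_sum_geometric; first exact: dom0.
  by move=> k; have [] := Edom k ts.
have int2 := integrable_RZl 2 (measurable_itv `]s, 0[) intdom.
have cur t : t \in `]s, 0[ -> Re (F n t) @[n --> \oo] --> Re (u t).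
  by move=> /Fu/cvg_complexP[].
have cui t : t \in `]s, 0[ -> Im (F n t) @[n --> \oo] --> Im (u t).
  by move=> /Fu/cvg_complexP[].
have mFr n : measurable_fun `]s, 0[ (fun t => Re (F n t)).
  by have [/integrable_EFin_measurable] := intF n.
have mFi n : measurable_fun `]s, 0[ (fun t => Im (F n t)).
  by have [_ /integrable_EFin_measurable] := intF n.
split.
  split.
    have [] // := @dominated_Rintegral R `]s, 0[ (fun n t => Re (F n t)) (fun t => Re (u t))
      (fun t => 2 * dom t).
  have [] // := @dominated_Rintegral R `]s, 0[ (fun n t => Im (F n t)) (fun t => Im (u t))
    (fun t => 2 * dom t).
move=> t ts.
have key (f_ : nat -> R -> R) (f : R -> R) :
    (forall n, measurable_fun `]s, 0[ (f_ n)) ->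
    (forall x, x \in `]s, 0[ -> f_ n x @[n --> \oo] --> f x) ->
    (forall n x, x \in `]s, 0[ -> `|f_ n x| <= 2 * dom x) ->
    fracint delta (f_ n) t @[n --> \oo] --> fracint delta f t.
  move=> mf_ cf bf.
  have [] // := @dominated_Rintegral R `]t, 0[ (fun n x => kern delta (x - t) * f_ n x)
    (fun x => kern delta (x - t) * f x) (fun x => kern delta (- s) * (2 * dom x)) _ _ _ _ _.
  - move=> n; apply: measurable_funM.
      by apply: measurable_funTS; exact: measurable_kern_shift.
    apply: measurable_funS (mf_ n) => //; apply: subset_itvr; rewrite bnd_simp; exact: itv_le.
  - by move=> x xt; apply: cvgMr; apply: cf; exact: itvW xt.
  - apply: integrable_RZl => //; exact: integrable_itvSr (itv_le ts) int2.
  - move=> n x xt; rewrite normrM ger0_norm ?kern_ge0// ler_pM ?kern_ge0//; last first.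
      by apply: bf; exact: itvW xt.
    apply: le_kern => //; move: (ts) (xt : x \in `]t, 0[).
    rewrite !in_itv/= => /andP[st _] /andP[_ x0].
    by rewrite -[leRHS]add0r lerB// ltW.
have cr := key _ _ mFr cur Fr; have ci := key _ _ mFi cui Fi.
have c2 : (F n.+1 t : R[i]^o) @[n --> \oo] --> (E 0 t + lambda * cfracint delta u t : R[i]^o).
  apply/cvg_complexP; rewrite Re_add Im_add Re_mul Im_mul; split.
    rewrite (_ : (fun n => _) = (fun n => Re (E 0 t) +
        (Re lambda * fracint delta (fun x => Re (F n x)) t
         - Im lambda * fracint delta (fun x => Im (F n x)) t))); last first.
      by apply/funext => n; rewrite FS// Re_add Re_mul.
    by apply: cvgD; [exact: cvg_cst|apply: cvgB; exact: cvgMr].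
  rewrite (_ : (fun n => _) = (fun n => Im (E 0 t) +
      (Re lambda * fracint delta (fun x => Im (F n x)) t
       + Im lambda * fracint delta (fun x => Re (F n x)) t))); last first.
    by apply/funext => n; rewrite FS// Im_add Im_mul.
  by apply: cvgD; [exact: cvg_cst|apply: cvgD; exact: cvgMr].
have c1 : (F n.+1 t : R[i]^o) @[n --> \oo] --> (u t : R[i]^o).
  by rewrite (cvg_shiftS (fun n => F n t : R[i]^o)); exact: Fu.
exact: (cvg_unique (@norm_hausdorff _ _) c1 c2).
Qed.

End volterra.

(** * Solving the Volterra equation by Mittag-Leffler functions *)

Section mittag_leffler_solution.
Variable R : realType.
Notation mu := (@lebesgue_measure R).

Lemma cfracintE a (f : R -> R[i]) t :
  cfracint a f t = cintegral `]t, 0[ (fun z => (kern a (z - t))%:C * f z).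
Proof.
by apply: complex_eq => /=; apply: eq_Rintegral => z _; rewrite ?Re_mulRl ?Im_mulRl.
Qed.

Lemma cfrac_cvP a (f : R -> R[i]) t :
  cfrac_cv a f t <-> cintegrable `]t, 0[ (fun z => (kern a (z - t))%:C * f z).
Proof.
by split => -[r i]; split; [move: r|move: i|move: r|move: i]; apply: eq_integrable => // z _;
  rewrite ?Re_mulRl ?Im_mulRl.
Qed.

Lemma cintegralD (D : set R) (f g : R -> R[i]) : measurable D ->
  cintegrable D f -> cintegrable D g ->
  cintegral D (fun x => f x + g x) = cintegral D f + cintegral D g.
Proof.
move=> mD [fr fi] [gr gi]; apply: complex_eq; rewrite ?Re_add ?Im_add/= -RintegralD//;
  by apply: eq_Rintegral => x _; rewrite ?Re_add ?Im_add.
Qed.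

Lemma cintegralZ (D : set R) c (f : R -> R[i]) : measurable D -> cintegrable D f ->
  cintegral D (fun x => c * f x) = c * cintegral D f.
Proof.
move=> mD [fr fi]; apply: complex_eq; rewrite ?Re_mul ?Im_mul/=.
  rewrite -mulNr -!RintegralZl// -RintegralD//; [|exact: integrable_RZl..].
  by apply: eq_Rintegral => x _; rewrite Re_mul mulNr.
rewrite -!RintegralZl// -RintegralD//; [|exact: integrable_RZl..].
by apply: eq_Rintegral => x _; rewrite Im_mul.
Qed.

Variables (s delta : R) (lambda : R[i]) (c xi0 xi1 : R) (g : R -> R[i]).
Hypotheses (s0 : s < 0) (delta1 : 1 <= delta) (c0 : 0 < c).
Hypothesis intg : cintegrable `]s, 0[ g.

Let delta0 : 0 < delta. Proof. by rewrite (lt_le_trans ltr01). Qed.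
Let Ns0 : 0 < - s. Proof. by rewrite oppr_gt0. Qed.

(** Closed form of the integral of order delta k of the inhomogeneous term. In the application [c]
    is gamma - 1. *)
Let E (k : nat) (t : R) : R[i] :=
  xi0%:C * (kern (delta * k%:R + c) (- t))%:C
  + - xi1%:C * (kern (delta * k%:R + (c + 1)) (- t))%:C
  + cfracint (delta * k%:R + delta) g t.

Definition ml_solution (t : R) : R[i] :=
  xi0%:C * ml_kern delta lambda c (- t) - xi1%:C * ml_kern delta lambda (c + 1) (- t)
  + cintegral `]t, 0[ (fun z => ml_kern delta lambda delta (z - t) * g z).

Let exp0 k a : 0 < a -> 0 < delta * k%:R + a.
Proof. by move=> a0; rewrite ltr_wpDl ?delta_natD_ge0. Qed.

Let c10 : 0 < c + 1. Proof. by rewrite addr_gt0. Qed.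

Let intE k : cintegrable `]s, 0[ (E k).
Proof.
apply: cintegrableD => //; last by apply: cfracint_integrable => //; exact: exp0.
by apply: cintegrableD => //; apply: cintegrableZ => //; apply: cintegrable_kern; exact: exp0.
Qed.

Let ES k : {in `]s, 0[, cfracint delta (E k) =1 E k.+1}.
Proof.
move=> t; rewrite in_itv/= => /andP[/ltW st t0].
have [cv1 e1] := cfracint_kern t (exp0 k c0) delta0.
have [cv2 e2] := cfracint_kern t (exp0 k c10) delta0.
have intgt := cintegrable_itvSr st intg.
have a1 : 1 <= delta + (delta * k%:R + delta) by rewrite ler_wpDr// ltW// exp0.
have [cv3 e3] := cfracint_semigroup delta0 (exp0 k delta0) intgt (cfrac_cv_ge1 a1 intgt).
rewrite /E cfracintD//; last by apply: cfrac_cvD; exact: cfrac_cvZ.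
rewrite cfracintD; [|exact: cfrac_cvZ..].
rewrite !cfracintZ// e1 e2 e3.
have aux a : delta + (delta * k%:R + a) = delta * k.+1%:R + a by rewrite -natr1; ring.
by rewrite !aux.
Qed.

Let EE k t : lambda ^+ k * E k t = xi0%:C * ml_term delta lambda c (- t) k
  + (- xi1)%:C * ml_term delta lambda (c + 1) (- t) k
  + lambda ^+ k * cfracint (delta * k%:R + delta) g t.
Proof.
rewrite /E /ml_term !mulrDr (_ : (- xi1)%:C = - xi1%:C); last exact: rmorphN.
by rewrite !(mulrCA (lambda ^+ k)).
Qed.

(** The kernels of orders c and c + 1 stay in the dominating function: that of order c is unbounded
    near 0 for c < 1, yet integrable. The contribution of g is bounded by a constant. *)
Let E_dom : exists2 dom : R -> R, mu.-integrable `]s, 0[ (EFin \o dom) &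
  forall k t, t \in `]s, 0[ ->
  `|Re (lambda ^+ k * E k t)| <= dom t * 2^-1 ^+ k /\
  `|Im (lambda ^+ k * E k t)| <= dom t * 2^-1 ^+ k.
Proof.
have [C1 C10 H1] := ml_term_Re_le lambda delta1 c0 Ns0.
have [C2 C20 H2] := ml_term_Re_le lambda delta1 c10 Ns0.
have [B B0 H3] := cfracint_geometric lambda s0 delta1 intg.
exists (fun t => `|xi0| * (C1 + kern c (- t)) + `|xi1| * (C2 + kern (c + 1) (- t)) + B).
  have ik a : 0 < a -> mu.-integrable `]s, 0[ (EFin \o (fun t => kern a (- t))).
    by move=> a0; have [] := cintegrable_kern s a0.
  (* [kern 1 (- y)] is 1 for y < 0, so a constant is a multiple of an integrable kernel. *)
  have ic (x : R) : mu.-integrable `]s, 0[ (EFin \o (fun=> x)).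
    apply: eq_integrable (integrable_RZl x (measurable_itv _) (ik 1 ltr01)) => // y.
    by rewrite inE/= in_itv/= => /andP[_ y0]; rewrite kern1 ?oppr_gt0// mulr1.
  by do !apply: integrable_RD => //; apply: integrable_RZl => //;
    apply: integrable_RD => //; exact: ik.
move=> k t ts; have [h3 h3'] := H3 k t ts.
have t0 : 0 < - t by move: ts; rewrite in_itv/= oppr_gt0 => /andP[].
have ts' : - t <= - s by move: ts; rewrite in_itv/= lerN2 => /andP[/ltW].
have [h1 h1'] := H1 k _ t0 ts'; have [h2 h2'] := H2 k _ t0 ts'.
rewrite EE !Re_add !Im_add !Re_mulRl !Im_mulRl !mulrDl; split.
  apply: le_trans (ler_normD _ _) _; apply: lerD => //.
  apply: le_trans (ler_normD _ _) _; rewrite !normrM normrN -!mulrA.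
  by apply: lerD; apply: ler_wpM2l.
apply: le_trans (ler_normD _ _) _; apply: lerD => //.
apply: le_trans (ler_normD _ _) _; rewrite !normrM normrN -!mulrA.
by apply: lerD; apply: ler_wpM2l.
Qed.

Let F n t : R[i] := \sum_(0 <= k < n) lambda ^+ k * E k t.

Let sum_cfracint n t : t \in `]s, 0[ ->
  \sum_(0 <= k < n) lambda ^+ k * cfracint (delta * k%:R + delta) g t =
  cintegral `]t, 0[ (fun z => series (ml_term delta lambda delta (z - t)) n * g z) /\
  cintegrable `]t, 0[ (fun z => series (ml_term delta lambda delta (z - t)) n * g z).
Proof.
rewrite in_itv/= => /andP[/ltW st t0]; have intgt := cintegrable_itvSr st intg.
elim: n => [|n [IHE IHi]].
  have -> : (fun z => series (ml_term delta lambda delta (z - t)) 0 * g z) = fun=> 0.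
    by apply/funext => z; rewrite /series/= big_nil mul0r.
  split; last by split; exact: integrable0.
  rewrite big_nil; apply: complex_eq => /=; rewrite /Rintegral.
    by rewrite (_ : (fun _ => _) = cst 0%E) ?integral0.
  by rewrite (_ : (fun _ => _) = cst 0%E) ?integral0.
have a1 : 1 <= delta * n%:R + delta by rewrite ler_wpDl ?delta_natD_ge0.
have cv : cintegrable `]t, 0[ (fun z => (kern (delta * n%:R + delta) (z - t))%:C * g z).
  by apply/cfrac_cvP; exact: cfrac_cv_ge1.
have eqf : (fun z => series (ml_term delta lambda delta (z - t)) n * g z
    + lambda ^+ n * ((kern (delta * n%:R + delta) (z - t))%:C * g z)) =
   (fun z => series (ml_term delta lambda delta (z - t)) n.+1 * g z).
  by apply/funext => z; rewrite /series/= big_nat_recr//= mulrDl mulrA.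
split; last by rewrite -eqf; apply: cintegrableD => //; exact: cintegrableZ.
rewrite big_nat_recr//= IHE cfracintE -eqf cintegralD ?cintegralZ//.
exact: cintegrableZ.
Qed.

(** Dominated convergence under the integral: since delta >= 1, the partial sums are bounded by one
    constant [K] on the whole interval, and |Re g| + |Im g| is integrable. *)
Let sum_cfracint_cvg t : t \in `]s, 0[ ->
  ((\sum_(0 <= k < n) lambda ^+ k * cfracint (delta * k%:R + delta) g t : R[i]^o)
     @[n --> \oo] -->
   (cintegral `]t, 0[ (fun z => ml_kern delta lambda delta (z - t) * g z) : R[i]^o)).
Proof.
move=> ts.
rewrite (_ : (fun n => _) = (fun n => cintegral `]t, 0[
    (fun z => series (ml_term delta lambda delta (z - t)) n * g z) : R[i]^o)); last first.
  by apply/funext => n; have [] := sum_cfracint n ts.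
have [C C0 H] := ml_series_le lambda delta1 delta0 Ns0.
have st : s <= t by move: ts; rewrite in_itv/= => /andP[/ltW].
have [gr gi] := cintegrable_itvSr st intg.
pose K := 2 * (C + kern delta (- s)).
have K0 : 0 <= K by rewrite mulr_ge0// addr_ge0// kern_ge0.
have bK n z : z \in `]t, 0[ ->
    `|Re (series (ml_term delta lambda delta (z - t)) n)| <= K /\
    `|Im (series (ml_term delta lambda delta (z - t)) n)| <= K.
  rewrite in_itv/= => /andP[tz z0].
  have zt0 : 0 < z - t by rewrite subr_gt0.
  have zts : z - t <= - s by rewrite -[leRHS]add0r lerB// ltW.
  have [hr hi] := H n _ zt0 zts.
  have kk : 2 * (C + kern delta (z - t)) <= K.
    by rewrite ler_wpM2l// lerD2l le_kern.
  by split; [exact: le_trans hr kk|exact: le_trans hi kk].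
have cML z : z \in `]t, 0[ ->
    Re (series (ml_term delta lambda delta (z - t)) n) @[n --> \oo] -->
      Re (ml_kern delta lambda delta (z - t)) /\
    Im (series (ml_term delta lambda delta (z - t)) n) @[n --> \oo] -->
      Im (ml_kern delta lambda delta (z - t)).
  rewrite in_itv/= => /andP[tz z0]; apply: ml_series_cvg => //; by rewrite subr_gt0.
have idom : mu.-integrable `]t, 0[ (EFin \o (fun z => K * (`|Re (g z)| + `|Im (g z)|))).
  apply: integrable_RZl => //; apply: integrable_RD => //; exact: integrable_norm.
apply/cvg_complexP; split.
  have [] // := @dominated_Rintegral R `]t, 0[
    (fun n z => Re (series (ml_term delta lambda delta (z - t)) n * g z))
    (fun z => Re (ml_kern delta lambda delta (z - t) * g z)) _ (measurable_itv _) _ _ idom _.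
  - by move=> n; have [_ [/integrable_EFin_measurable]] := sum_cfracint n ts.
  - move=> z zt; have [cr ci] := cML z zt.
    rewrite Re_mul; under eq_fun do rewrite Re_mul.
    by apply: cvgB; exact: cvgMl.
  - move=> n z zt; have [hr hi] := bK n z zt.
    rewrite Re_mul (le_trans (ler_normB _ _))// mulrDr !normrM.
    by apply: lerD; apply: ler_wpM2r.
have [] // := @dominated_Rintegral R `]t, 0[
  (fun n z => Im (series (ml_term delta lambda delta (z - t)) n * g z))
  (fun z => Im (ml_kern delta lambda delta (z - t) * g z)) _ (measurable_itv _) _ _ idom _.
- by move=> n; have [_ [_ /integrable_EFin_measurable]] := sum_cfracint n ts.
- move=> z zt; have [cr ci] := cML z zt.
  rewrite Im_mul; under eq_fun do rewrite Im_mul.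
  by apply: cvgD; exact: cvgMl.
- move=> n z zt; have [hr hi] := bK n z zt.
  rewrite Im_mul (le_trans (ler_normD _ _))// mulrDr !normrM [leLHS]addrC.
  by apply: lerD; apply: ler_wpM2r.
Qed.

Let F_cvg : {in `]s, 0[, forall t,
  (F n t : R[i]^o) @[n --> \oo] --> (ml_solution t : R[i]^o)}.
Proof.
move=> t ts; have t0 : 0 < - t by move: ts; rewrite in_itv/= oppr_gt0 => /andP[].
have [r1 i1] := ml_series_cvg lambda delta1 c0 t0.
have [r2 i2] := ml_series_cvg lambda delta1 c10 t0.
have /cvg_complexP[r3 i3] := sum_cfracint_cvg ts.
have FE n : F n t = xi0%:C * series (ml_term delta lambda c (- t)) n
  + (- xi1)%:C * series (ml_term delta lambda (c + 1) (- t)) n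
  + \sum_(0 <= k < n) lambda ^+ k * cfracint (delta * k%:R + delta) g t.
  rewrite /F /series/= !mulr_sumr -!big_split/=; apply: eq_bigr => k _; exact: EE.
have SE : ml_solution t = xi0%:C * ml_kern delta lambda c (- t)
  + (- xi1)%:C * ml_kern delta lambda (c + 1) (- t)
  + cintegral `]t, 0[ (fun z => ml_kern delta lambda delta (z - t) * g z).
  by rewrite /ml_solution (_ : (- xi1)%:C = - xi1%:C) ?mulNr//; exact: rmorphN.
apply/cvg_complexP; rewrite SE !Re_add !Im_add.
rewrite !(Re_mulRl xi0) !(Re_mulRl (- xi1)) !(Im_mulRl xi0) !(Im_mulRl (- xi1)); split.
  under eq_fun do rewrite FE !Re_add (Re_mulRl xi0) (Re_mulRl (- xi1)).
  by apply: cvgD => //; apply: cvgD; exact: cvgMr.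
under eq_fun do rewrite FE !Im_add (Im_mulRl xi0) (Im_mulRl (- xi1)).
by apply: cvgD => //; apply: cvgD; exact: cvgMr.
Qed.

Let E0 t : E 0 t = xi0%:C * (kern c (- t))%:C - xi1%:C * (kern (c + 1) (- t))%:C
  + cfracint delta g t.
Proof. by rewrite /E mulr0 !add0r mulNr. Qed.

(** Both u and [ml_solution] are the limit of the partial sums [F n]. *)
Lemma volterra_ml_solution u : cintegrable `]s, 0[ u ->
  {in `]s, 0[, forall t, u t = xi0%:C * (kern c (- t))%:C - xi1%:C * (kern (c + 1) (- t))%:C
     + cfracint delta g t + lambda * cfracint delta u t} ->
  {in `]s, 0[, u =1 ml_solution}.
Proof.
move=> intu uE t ts.
have uE' : {in `]s, 0[, forall t, u t = E 0 t + lambda * cfracint delta u t}.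
  by move=> x xs; rewrite E0 uE.
have cu := volterra_unique s0 delta1 intE ES intu uE' ts.
exact: (cvg_unique (@norm_hausdorff _ _) cu (F_cvg ts)).
Qed.

Lemma ml_solution_volterra u : {in `]s, 0[, u =1 ml_solution} ->
  cintegrable `]s, 0[ u /\
  {in `]s, 0[, forall t, u t = xi0%:C * (kern c (- t))%:C - xi1%:C * (kern (c + 1) (- t))%:C
     + cfracint delta g t + lambda * cfracint delta u t}.
Proof.
move=> uS; have [dom idom Edom] := E_dom.
have Fu : {in `]s, 0[, forall t, (F n t : R[i]^o) @[n --> \oo] --> (u t : R[i]^o)}.
  by move=> t ts; rewrite uS//; exact: F_cvg.
have [intu uE] := volterra_exists delta1 intE ES idom Edom Fu.
by split => // t ts; rewrite uE// E0.
Qed.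

End mittag_leffler_solution.

(** * The Cauchy problem *)

Section hilfer.
Variable R : realType.
Notation mu := (@lebesgue_measure R).
Implicit Types (a b s t : R) (f g h u v w : R -> R[i]).

Lemma kern2 (x : R) : 0 < x -> kern (1 + 1) x = x.
Proof.
move=> x0; have G2 : Gamma (1 + 1 : R) = 1.
  by apply: EFin_inj; rewrite GammaE ?egammaS// egamma1 mule1.
by rewrite kern_gt0// addrK powRr1 ?ltW// G2 divr1.
Qed.

Lemma kern_opp_continuous a t : t < 0 ->
  {for t, continuous (fun x => (kern a (- x))%:C : R[i]^o)}.
Proof.
move=> t0; apply/continuous_complexP; split; last exact: cst_continuous.
have Nt0 : 0 < - t by rewrite oppr_gt0.
have cp : {for t, continuous (fun x : R => (- x) `^ (a - 1) / Gamma a)}.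
  apply: cvgMl; apply: (@continuous_comp _ _ _ (fun x : R => - x) (@powR R ^~ (a - 1))).
    exact: oppr_continuous.
  have ? := is_derive1_powR (a - 1) Nt0.
  exact/differentiable_continuous/derivable1_diffP.
rewrite /prop_for /continuous_at /= kern_gt0//; apply: cvg_trans cp; apply: near_eq_cvg.
by near=> x; rewrite kern_gt0// oppr_gt0; near: x; exact: lt_nbhsl.
Unshelve. all: by end_near. Qed.

(** Used with f the twice iterated derivative of w, known only almost everywhere and not known to be
    measurable. *)
Lemma ae_eq_RL_integral a f g t : a != 0 ->
  {ae mu, forall x, x \in `]t, 0[ -> f x = g x} -> RL_integral a f t = RL_integral a g t.
Proof.
move=> a0 fg; rewrite /RL_integral (negbTE a0); congr (_ * _).
apply: complex_eq => /=; apply: ae_eq_Rintegral; apply: ae_imply fg => x + xt;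
  by rewrite /RL_kernel => ->.
Qed.

Lemma iter_derive_taylor2 s (w v : R -> R) (xi0 xi1 t : R) : s < 0 ->
  mu.-integrable `]s, 0[ (EFin \o v) ->
  {in `]s, 0[, forall t, w t = xi0 + xi1 * t + fracint (1 + 1) v t} ->
  t \in `]s, 0[ -> is_derive t 1 (fracint 1 v) (- v t) ->
  - derive1 (fun x => - derive1 w x) t = v t.
Proof.
move=> s0 intv wE ts dv; have [dw _ _ _] := taylor2_converse s0 intv wE.
have d : is_derive t 1 (fun x => - (xi1 - fracint 1 v x)) (- v t).
  have d0 := is_deriveB (is_derive_cst xi1 t 1) dv.
  by apply: (is_derive_eq (is_deriveN d0)); rewrite sub0r opprK.
have d' : is_derive t 1 (fun x => - derive1 w x) (- v t).
  apply: near_eq_is_derive d.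
  have := in_itv_oo_near ts; apply: filterS => x xs.
  by rewrite derive1E; have ? := dw _ xs; rewrite derive_val.
by rewrite derive1E derive_val opprK.
Qed.

(** The operator iterated in [bihilfer], named so that [iter 2 nderive w] is convertible to what
    occurs there. *)
Definition nderive f (t : R) : R[i] := - cderive f t.

(* For t < 0, kern 1 (- t) = 1 and kern 2 (- t) = - t. *)
Definition ctaylor2 (xi0 xi1 : R) v t : R[i] :=
  xi0%:C * (kern 1 (- t))%:C - xi1%:C * (kern (1 + 1) (- t))%:C + cfracint (1 + 1) v t.

Lemma ctaylor2E xi0 xi1 v t : t < 0 ->
  Re (ctaylor2 xi0 xi1 v t) = xi0 + xi1 * t + fracint (1 + 1) (fun x => Re (v x)) t /\
  Im (ctaylor2 xi0 xi1 v t) = 0 + 0 * t + fracint (1 + 1) (fun x => Im (v x)) t.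
Proof.
move=> t0; rewrite /ctaylor2 Re_add Im_add Re_sub Im_sub !Re_mulRl !Im_mulRl.
have Nt0 : 0 < - t by rewrite oppr_gt0.
rewrite -!complexr0/= kern1// kern2// !mulr0 !mul0r subr0 addr0 mulr1 mulrN opprK; split=> //.
Qed.

(** The almost everywhere equality suffices under an outer integral of positive order. The pointwise
    one is for nu = 0, where the outer integral is the identity and the equation must hold at each
    t. *)
Lemma iter_nderive_ctaylor2 s w v xi0 xi1 : s < 0 -> cintegrable `]s, 0[ v ->
  {in `]s, 0[, w =1 ctaylor2 xi0 xi1 v} ->
  {ae mu, forall t, t \in `]s, 0[ -> iter 2 nderive w t = v t} /\
  forall t, t \in `]s, 0[ -> {for t, continuous (v : R -> R[i]^o)} -> iter 2 nderive w t = v t.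
Proof.
move=> s0 [vr vi] wE.
have wr : {in `]s, 0[, forall t, Re (w t) = xi0 + xi1 * t + fracint (1 + 1) (fun x => Re (v x)) t}.
  by move=> t ts; rewrite wE//; move: ts; rewrite in_itv/= => /andP[_ /(ctaylor2E xi0 xi1 v)[]].
have wi : {in `]s, 0[, forall t, Im (w t) = 0 + 0 * t + fracint (1 + 1) (fun x => Im (v x)) t}.
  by move=> t ts; rewrite wE//; move: ts; rewrite in_itv/= => /andP[_ /(ctaylor2E xi0 xi1 v)[]].
have key t : t \in `]s, 0[ ->
    is_derive t 1 (fracint 1 (fun x => Re (v x))) (- Re (v t)) ->
    is_derive t 1 (fracint 1 (fun x => Im (v x))) (- Im (v t)) ->
    iter 2 nderive w t = v t.
  move=> ts dr di; apply: complex_eq.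
    exact: (iter_derive_taylor2 s0 vr wr ts dr).
  exact: (iter_derive_taylor2 s0 vi wi ts di).
split.
  have := fracint1_derive_ae vi; have := fracint1_derive_ae vr.
  apply: ae_imply2 => t dr di ts; exact: key ts (dr ts) (di ts).
move=> t ts /continuous_complexP[cr ci].
exact: key ts (fracint1_derive vr ts cr) (fracint1_derive vi ts ci).
Qed.

(** For nu > 0 this is the semigroup law applied to I^nu v = h. For nu = 0 that hypothesis becomes v
    = h almost everywhere, since [cfracint 0] is not the identity. *)
Lemma cfracint_transfer s nu v h : 0 <= nu -> cintegrable `]s, 0[ v ->
  (nu = 0 -> {ae mu, forall t, t \in `]s, 0[ -> v t = h t}) ->
  (nu != 0 -> {in `]s, 0[, cfracint nu v =1 h}) ->
  forall a t, 1 <= a -> t \in `]s, 0[ -> cfracint (a + nu) v t = cfracint a h t.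
Proof.
move=> nu0 intv hae heq a t a1 ts; have a0 : 0 < a by rewrite (lt_le_trans ltr01).
have sub x : x \in `]t, 0[ -> x \in `]s, 0[.
  move: ts; rewrite !in_itv/= => /andP[st _] /andP[tx ->].
  by rewrite (lt_trans st).
have [n0|n0] := eqVneq nu 0.
  rewrite n0 addr0; have := hae n0.
  move=> vh; apply: complex_eq => /=; apply: ae_eq_Rintegral; apply: ae_imply vh => x + xt => ->//;
    exact: sub.
have nu1 : 0 < nu by rewrite lt0r n0.
rewrite -(@eq_cfracint _ a (cfracint nu v) h); last by move=> x /sub; exact: heq.
rewrite cfracint_semigroup_ge1//; first by rewrite ler_wpDr.
by apply: cintegrable_itvSr intv; move: ts; rewrite in_itv/= => /andP[/ltW].
Qed.

(** The excess over 1 is the convex combination of a - 1 and b - 1 with weights m and 1 - m. With a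
    = 2 it also gives gamma > 1. *)
Lemma bi_ordinal_gt1 (a b m : R) : 1 < a -> 1 < b -> 0 <= m <= 1 -> 1 < b + m * (a - b).
Proof.
move=> a1 b1 /andP[m0 m1]; rewrite (_ : b + m * (a - b) = 1 + (m * (a - 1) + (1 - m) * (b - 1))).
  rewrite ltrDl; have [m2|m2] := ltP 0 m.
    by rewrite ltr_wpDr ?mulr_gt0 ?mulr_ge0 ?subr_ge0 ?subr_gt0// ltW.
  by rewrite ltr_wpDl ?mulr_ge0 ?mulr_gt0 ?subr_ge0 ?subr_gt0 ?(le_lt_trans m2)// ltW.
by ring.
Qed.

Lemma within_continuous_cintegrable (a b : R) f :
  {within `[a, b], continuous (f : R -> R[i]^o)} -> cintegrable `]a, b[ f.
Proof.
move=> /within_continuous_complex[cr ci].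
have intc (k : R -> R) : {within `[a, b], continuous k} -> mu.-integrable `]a, b[ (EFin \o k).
  move=> ck; apply: (@integrableS _ _ _ mu `[a, b]) => //; first exact: subset_itv_oo_cc.
  by apply: continuous_compact_integrable => //; exact: segment_compact.
by split; exact: intc.
Qed.

Section cauchy.
Variables (T alpha beta theta : R) (lambda : R[i]) (xi0 xi1 : R) (g g' u : R -> R[i]).
Hypotheses (hT : 0 < T) (halpha : 1 < alpha <= 2) (hbeta : 1 < beta <= 2).
Hypothesis hnu : 0 <= theta <= 1.
Hypothesis hg : {within `[- T, 0], continuous (g : R -> R[i]^o)}.
Hypothesis hg' : L1_derivative (- T) 0 g g'.

(** The type of the derivative is called [theta] in this section, where [mu] is the Lebesgue
    measure. *)
Let gamma := beta + theta * (2 - beta).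
Let delta := beta + theta * (alpha - beta).
Let nu := theta * (2 - alpha).
Let h t := lambda * u t + g t.

Let s0 : - T < 0. Proof. by rewrite oppr_lt0. Qed.

Let delta1 : 1 < delta.
Proof. by move: halpha hbeta => /andP[a1 _] /andP[b1 _]; exact: bi_ordinal_gt1. Qed.

Let order_ge0 : 0 <= nu.
Proof. by case/andP: hnu halpha => ? ? /andP[_ ?]; rewrite mulr_ge0// subr_ge0. Qed.

Let order_lt1 : nu < 1.
Proof.
move: halpha hnu => /andP[a1 a2] /andP[n0 n1].
apply: (@le_lt_trans _ _ (1 * (2 - alpha))); first by rewrite ler_wpM2r// subr_ge0.
by rewrite mul1r; lra.
Qed.

Let gammaE : gamma = delta + nu. Proof. by rewrite /gamma /delta /nu; ring. Qed.

Let gamma_le2 : gamma <= 2.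
Proof.
move: hbeta hnu => /andP[b1 b2] /andP[n0 n1].
have : (1 - theta) * (2 - beta) >= 0 by rewrite mulr_ge0// subr_ge0.
rewrite /gamma; nra.
Qed.

Let gamma1_gt0 : 0 < gamma - 1.
Proof.
by move: hbeta => /andP[b1 _]; rewrite subr_gt0; apply: bi_ordinal_gt1 => //; rewrite ltr1n.
Qed.

Let delta_nu : 0 < delta - nu.
Proof. by rewrite subr_gt0 (lt_trans order_lt1). Qed.

Let order_inner : (1 - theta) * (2 - beta) = 2 - gamma.
Proof. by rewrite /gamma; ring. Qed.

Let g_cont : {in `]- T, 0[, continuous (g : R -> R[i]^o)}.
Proof.
have [cr ci] := within_continuous_complex hg.
have [+ _ _] := (continuous_within_itvP _ s0).1 cr; move=> cr'.
have [+ _ _] := (continuous_within_itvP _ s0).1 ci; move=> ci'.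
by move=> t ts; apply/continuous_complexP; split; [exact: cr'|exact: ci'].
Qed.

Let g_int : cintegrable `]- T, 0[ g.
Proof. exact: within_continuous_cintegrable. Qed.

Let g_primitive : {in `]- T, 0[, forall t, g t = g 0 - cfracint 1 g' t}.
Proof.
have [cr ci] := within_continuous_complex hg.
have [_ _ r0] := (continuous_within_itvP _ s0).1 cr.
have [_ _ i0] := (continuous_within_itvP _ s0).1 ci.
case: hg' => -[ir ii] incr.
have er := fracint1_left_limit s0 ir _ r0; have ei := fracint1_left_limit s0 ii _ i0.
move=> t ts; apply: complex_eq.
  rewrite Re_sub -er// => x y sx xy y0; rewrite -Re_sub incr//.
rewrite Im_sub -ei// => x y sx xy y0; rewrite -Im_sub incr//.
Qed.

Let h_int : cintegrable `]- T, 0[ u -> cintegrable `]- T, 0[ h.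
Proof. by move=> intu; apply: cintegrableD => //; exact: cintegrableZ. Qed.

Let h_cont t : t \in `]- T, 0[ -> {for t, continuous (u : R -> R[i]^o)} ->
  {for t, continuous (h : R -> R[i]^o)}.
Proof.
move=> ts cu; apply: continuous_complexD; last exact: g_cont.
exact: continuous_complexZ.
Qed.

(** Written with gamma - 1 + 1 and separate integrals of g and u, as in [volterra_ml_solution] for c
    = gamma - 1; [F] is the grouped form. *)
Definition volterra_eq : Prop := cintegrable `]- T, 0[ u /\
  {in `]- T, 0[, forall t, u t =
    xi0%:C * (kern (gamma - 1) (- t))%:C - xi1%:C * (kern (gamma - 1 + 1) (- t))%:C
    + cfracint delta g t + lambda * cfracint delta u t}.

Let F t := xi0%:C * (kern (gamma - 1) (- t))%:C - xi1%:C * (kern gamma (- t))%:C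
  + cfracint delta h t.

Let cfracint_h t : cintegrable `]- T, 0[ u -> t \in `]- T, 0[ ->
  cfracint delta h t = cfracint delta g t + lambda * cfracint delta u t.
Proof.
move=> intu; rewrite in_itv/= => /andP[/ltW st _].
have cv f : cintegrable `]- T, 0[ f -> cfrac_cv delta f t.
  by move=> intf; apply: cfrac_cv_ge1; [exact: ltW|exact: cintegrable_itvSr intf].
rewrite cfracintD ?cfracintZ 1?addrC//; [exact: cv| |exact: cv].
by apply: cfrac_cvZ; exact: cv.
Qed.

Let volterraP : volterra_eq <-> cintegrable `]- T, 0[ u /\ {in `]- T, 0[, u =1 F}.
Proof.
split=> -[intu uE]; split=> // t ts.
  by rewrite /F cfracint_h// uE// subrK addrA.
by rewrite uE// /F cfracint_h// subrK addrA.
Qed.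

Let F_int : cintegrable `]- T, 0[ u -> cintegrable `]- T, 0[ F.
Proof.
move=> intu; have d0 : 0 < delta by rewrite (lt_trans ltr01).
have g0 : 0 < gamma by rewrite (lt_trans gamma1_gt0)// gtrBl.
apply: cintegrableD => //; last by apply: cfracint_integrable => //; exact: h_int.
apply: (@eq_cintegrable _ _ (fun t => xi0%:C * (kern (gamma - 1) (- t))%:C +
  - xi1%:C * (kern gamma (- t))%:C)) => //; first by move=> x _; rewrite mulNr.
by apply: cintegrableD => //; apply: cintegrableZ => //; exact: cintegrable_kern.
Qed.

Let F_cont : cintegrable `]- T, 0[ u -> {in `]- T, 0[, continuous (F : R -> R[i]^o)}.
Proof.
move=> intu t ts; have t0 : t < 0 by move: ts; rewrite in_itv/= => /andP[].
apply: continuous_complexD; last exact: (cfracint_continuous s0 delta1 (h_int intu) ts).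
rewrite (_ : (fun x => _) = (fun x => xi0%:C * (kern (gamma - 1) (- x))%:C +
  - xi1%:C * (kern gamma (- x))%:C)); last by apply/funext => x; rewrite mulNr.
by apply: continuous_complexD; apply: continuous_complexZ; exact: kern_opp_continuous.
Qed.

Let gamma_gt0 : 0 < gamma. Proof. by rewrite (lt_trans gamma1_gt0)// gtrBl. Qed.
Let delta_gt0 : 0 < delta. Proof. by rewrite (lt_trans ltr01). Qed.

Let itv_ge t : t \in `]- T, 0[ -> - T <= t.
Proof. by rewrite in_itv/= => /andP[/ltW]. Qed.

Let sub_itv t x : t \in `]- T, 0[ -> x \in `]t, 0[ -> x \in `]- T, 0[.
Proof. by rewrite !in_itv/= => /andP[st _] /andP[tx ->]; rewrite (lt_trans st). Qed.

Lemma cauchy_solution_volterra :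
  cauchy_solution T alpha beta theta lambda xi0 xi1 g u -> volterra_eq.
Proof.
case=> -[]; rewrite /bihilfer order_inner -/nu -/gamma.
set w := RL_integral (2 - gamma) u.
move=> cu intu dw [v [intv incr] cvv] eqn wl wl'.
(* The initial data are real, so the imaginary part of w has initial values 0 and 0. *)
have wE : {in `]- T, 0[, w =1 ctaylor2 xi0 xi1 v}.
  have /cvg_complexP[l0r l0i] := wl; have /cvg_complexP[l1r l1i] := wl'.
  case: intv => [vr vi].
  have er := @taylor2 R (- T) (fun t => Re (w t)) (fun t => Re (v t)) xi0 xi1 s0 vr.
  have ei := @taylor2 R (- T) (fun t => Im (w t)) (fun t => Im (v t)) 0 0 s0 vi.
  move=> t ts; have t0 : t < 0 by move: ts; rewrite in_itv/= => /andP[].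
  have [cr ci] := ctaylor2E xi0 xi1 v t0; apply: complex_eq.
    rewrite cr; apply: er => //; first by move=> x /dw[].
    by move=> x y sx xy y0; have [] := incr x y sx xy y0.
  rewrite ci; apply: ei => //; first by move=> x /dw[].
  by move=> x y sx xy y0; have [] := incr x y sx xy y0.
have [aev _] := iter_nderive_ctaylor2 s0 intv wE.
have tr : forall a t, 1 <= a -> t \in `]- T, 0[ -> cfracint (a + nu) v t = cfracint a h t.
  apply: (cfracint_transfer order_ge0 intv).
    move=> n0; apply: ae_imply aev => t vt ts; have := eqn t ts.
    by rewrite /RL_integral n0 eqxx -vt.
  move=> n0 t ts; have n1 : 0 < nu by rewrite lt0r n0.
  rewrite -RL_integralE//; last exact: cintegrable_itvSr (itv_ge ts) intv.
  rewrite -[RHS]eqn//; apply: ae_eq_RL_integral => //.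
  apply: ae_imply aev => x xv xt; rewrite -xv//; exact: sub_itv xt.
apply/volterraP; split => //.
(* Both u and [F] are continuous and integrable, so it is enough to compare their integrals of order
   1. *)
apply: (cfracint1_inj s0 intu (F_int intu) cu (F_cont intu)).
move=> t ts; have intut := cintegrable_itvSr (itv_ge ts) intu.
have intvt := cintegrable_itvSr (itv_ge ts) intv.
have intht := cintegrable_itvSr (itv_ge ts) (h_int intu).
(* The orders gamma - 1 and 2 - gamma add up to 1. At gamma = 2 the inner integral is the identity,
   and w is u. *)
have -> : cfracint 1 u t = cfracint (gamma - 1) w t.
  have [g2|g2] := eqVneq gamma 2.
    by rewrite /w /RL_integral g2 subrr eqxx; congr (cfracint _ _ _); ring.
  have g2' : 0 < 2 - gamma by rewrite subr_gt0 lt_neqAle g2.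
  rewrite (@eq_cfracint _ _ w (cfracint (2 - gamma) u)); last first.
    move=> x xt; rewrite /w RL_integralE//.
    by apply: cintegrable_itvSr intu; apply: itv_ge; exact: sub_itv xt.
  have e1 : gamma - 1 + (2 - gamma) = 1 by ring.
  by rewrite cfracint_semigroup_ge1 ?e1.
rewrite (@eq_cfracint _ _ w (ctaylor2 xi0 xi1 v)); last first.
  by move=> x xt; apply: wE; exact: sub_itv xt.
have a2 : 1 <= gamma - 1 + (1 + 1) by rewrite ler_wpDl// ?lerDl// ltW.
have [cv2 e2] := cfracint_semigroup gamma1_gt0 (addr_gt0 ltr01 ltr01) intvt (cfrac_cv_ge1 a2 intvt).
have a3 : 1 <= 1 + delta by rewrite lerDl ltW.
have [cv3 e3] := cfracint_semigroup ltr01 delta_gt0 intht (cfrac_cv_ge1 a3 intht).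
have [_ ->] := cfracint_kernD xi0 xi1 gamma1_gt0 ltr01 (addr_gt0 ltr01 ltr01) cv2.
have [_ ->] := cfracint_kernD xi0 xi1 ltr01 gamma1_gt0 gamma_gt0 cv3.
(* As gamma - 1 + 2 = (1 + delta) + nu, the integral of v of this order is I^(1+delta) h. *)
rewrite e2 e3 -tr//; congr (_ - _ * (kern _ _)%:C + cfracint _ _ _).
- by congr (_ * (kern _ _)%:C); ring.
- by ring.
- by rewrite gammaE; ring.
Qed.

(* v is the fractional derivative of order nu of h = lambda F + g, taken term by
   term, with g = g(0) kern 1 (- t) - I^1 g'. *)
Let right_inverse : cintegrable `]- T, 0[ u -> {in `]- T, 0[, u =1 F} -> exists v,
  [/\ cintegrable `]- T, 0[ v, nu = 0 -> v = h,
    nu != 0 -> forall t, t \in `]- T, 0[ -> cfrac_cv nu v t &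
    nu != 0 -> {in `]- T, 0[, cfracint nu v =1 h}].
Proof.
move=> intu uF; have inth := h_int intu.
have [n0|n0] := eqVneq nu 0.
  by exists h; split.
have nu0 : 0 < nu by rewrite lt0r n0.
have nu1 : 0 < 1 - nu by rewrite subr_gt0.
have d10 : 0 < delta - 1 by rewrite subr_gt0.
have intg' : cintegrable `]- T, 0[ g' by case: hg'.
(* The orders in [F] lowered by nu: gamma - 1, gamma and delta become delta - 1, delta and delta -
   nu. All are positive because delta > 1 > nu, so [A] is integrable. *)
pose A t := xi0%:C * (kern (delta - 1) (- t))%:C - xi1%:C * (kern delta (- t))%:C
  + cfracint (delta - nu) h t.
pose B t := g 0 * (kern (1 - nu) (- t))%:C + -1 * cfracint (1 - nu) g' t.
exists (fun t => lambda * A t + B t).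
have H t : t \in `]- T, 0[ -> [/\ cfrac_cv nu A t, cfracint nu A t = F t,
    cfrac_cv nu B t & cfracint nu B t = g t].
  move=> ts; have intht := cintegrable_itvSr (itv_ge ts) inth.
  have intgt := cintegrable_itvSr (itv_ge ts) intg'.
  have t0 : 0 < - t by move: ts; rewrite in_itv/= oppr_gt0 => /andP[].
  have e1 : nu + (delta - nu) = delta by ring.
  have e2 : nu + (1 - nu) = 1 by ring.
  have e3 : nu + (delta - 1) = gamma - 1 by rewrite gammaE; ring.
  have e4 : nu + delta = gamma by rewrite gammaE addrC.
  (* Convergence at order nu < 1 is not automatic; the total orders delta and 1 are at least 1, and
     the semigroup law transfers convergence. *)
  have c1 : cfrac_cv (nu + (delta - nu)) h t by rewrite e1; apply: cfrac_cv_ge1 => //; exact: ltW.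
  have [cv1 E1] := cfracint_semigroup nu0 delta_nu intht c1.
  have c2 : cfrac_cv (nu + (1 - nu)) g' t by rewrite e2; exact: cfrac_cv_ge1.
  have [cv2 E2] := cfracint_semigroup nu0 nu1 intgt c2.
  have [cv3 E3] := cfracint_kern t nu1 nu0.
  have [cvA EA] := cfracint_kernD xi0 xi1 nu0 d10 delta_gt0 cv1.
  split => //.
  - by rewrite EA E1 e1 e3 e4.
  - by apply: cfrac_cvD; exact: cfrac_cvZ.
  - rewrite cfracintD; [|exact: cfrac_cvZ..]; rewrite !cfracintZ// E2 E3 e2 kern1//.
    by rewrite mulr1 mulN1r -g_primitive.
split => //.
- have intA : cintegrable `]- T, 0[ A.
    apply: cintegrableD => //; last exact: cfracint_integrable.
    apply: (@eq_cintegrable _ _ (fun t => xi0%:C * (kern (delta - 1) (- t))%:C +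
      - xi1%:C * (kern delta (- t))%:C)) => //; first by move=> x _; rewrite mulNr.
    by apply: cintegrableD => //; apply: cintegrableZ => //; exact: cintegrable_kern.
  apply: cintegrableD => //; first exact: cintegrableZ.
  apply: cintegrableD => //; apply: cintegrableZ => //.
    exact: cintegrable_kern.
  exact: cfracint_integrable.
- by move=> n00; move: n0; rewrite n00 eqxx.
- by move=> _ t /H[cA _ cB _]; apply: cfrac_cvD => //; exact: cfrac_cvZ.
- move=> _ t ts; have [cA eA cB eB] := H t ts.
  rewrite cfracintD//; last exact: cfrac_cvZ.
  by rewrite cfracintZ// eA eB /h uF.
Qed.

Lemma volterra_cauchy_solution :
  volterra_eq -> cauchy_solution T alpha beta theta lambda xi0 xi1 g u.
Proof.
move=> /volterraP[intu uF].
have cu : {in `]- T, 0[, continuous (u : R -> R[i]^o)}.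
  move=> t ts; have := F_cont intu ts; rewrite /prop_for /continuous_at -uF//.
  apply: cvg_trans; apply: near_eq_cvg.
  by have := in_itv_oo_near ts; apply: filterS => x /uF.
have inth := h_int intu.
have [v [intv v0 vcv vE]] := right_inverse intu uF.
have tr : forall a t, 1 <= a -> t \in `]- T, 0[ -> cfracint (a + nu) v t = cfracint a h t.
  apply: (cfracint_transfer order_ge0 intv) => // n0.
  by rewrite v0//; exact: aeW.
(* With a = 2 - nu, [tr] reads I^2 v = I^(2-nu) h, and 2 - nu = (2 - gamma) + delta is the order
   that h acquires in I^(2-gamma) F. *)
have a2 : 1 <= 2 - nu by rewrite lerBrDr -lerBrDl (le_trans (ltW order_lt1))//; lra.
have e11 : 2 - nu + nu = 1 + 1 by ring.
pose w := RL_integral (2 - gamma) u.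
have wE : {in `]- T, 0[, w =1 ctaylor2 xi0 xi1 v}.
  move=> t ts; rewrite /ctaylor2 -e11 tr//.
  have [g2|g2] := eqVneq gamma 2.
    have -> : w t = u t by rewrite /w /RL_integral g2 subrr eqxx.
    rewrite uF// /F; congr (_ * (kern _ _)%:C - _ * (kern _ _)%:C + cfracint _ _ _).
    - by rewrite g2; ring.
    - by rewrite g2; ring.
    - by rewrite -g2 gammaE; ring.
  have g2' : 0 < 2 - gamma by rewrite subr_gt0 lt_neqAle g2.
  rewrite /w RL_integralE//; last exact: cintegrable_itvSr (itv_ge ts) intu.
  rewrite (@eq_cfracint _ _ u F); last by move=> x xt; apply: uF; exact: sub_itv xt.
  have intht := cintegrable_itvSr (itv_ge ts) inth.
  have e2 : 2 - gamma + delta = 2 - nu by rewrite gammaE; ring.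
  have c2 : cfrac_cv (2 - gamma + delta) h t by rewrite e2; exact: cfrac_cv_ge1.
  have [cv2 E2] := cfracint_semigroup g2' delta_gt0 intht c2.
  have [_ ->] := cfracint_kernD xi0 xi1 g2' gamma1_gt0 gamma_gt0 cv2.
  rewrite E2 e2; congr (_ * (kern _ _)%:C - _ * (kern _ _)%:C + _); by ring.
have [aev cev] := iter_nderive_ctaylor2 s0 intv wE.
have wr : {in `]- T, 0[, forall t,
    Re (w t) = xi0 + xi1 * t + fracint (1 + 1) (fun x => Re (v x)) t}.
  by move=> t ts; rewrite wE//; move: ts; rewrite in_itv/= => /andP[_ /(ctaylor2E xi0 xi1 v)[]].
have wi : {in `]- T, 0[, forall t,
    Im (w t) = 0 + 0 * t + fracint (1 + 1) (fun x => Im (v x)) t}.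
  by move=> t ts; rewrite wE//; move: ts; rewrite in_itv/= => /andP[_ /(ctaylor2E xi0 xi1 v)[]].
have [dr ir r0 r1] := taylor2_converse s0 intv.1 wr.
have [di ii i0 i1] := taylor2_converse s0 intv.2 wi.
split; [split => //|..]; rewrite /bihilfer ?order_inner -/nu -/gamma -/w //.
- move=> t ts; have d1 := dr t ts; have d2 := di t ts; split; exact: ex_derive.
- exists v.
    split=> // x y sx xy y0; apply: complex_eq; rewrite ?Re_sub ?Im_sub/=.
      exact: ir.
    exact: ii.
  move=> t ts; have [->|n0] := eqVneq nu 0; first by move=> /eqP.
  by apply/RL_convergentP; [rewrite lt0r n0|exact: vcv].
(* For nu = 0, v is h, which is continuous, so w'' = v at every point. Otherwise the outer integral
   sees w'' only up to a null set. *)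
- move=> t ts; have [n0|n0] := eqVneq nu 0.
    rewrite /RL_integral n0 eqxx -[LHS]/(iter 2 nderive w t) cev ?v0//.
    by apply: h_cont => //; exact: cu.
  rewrite (@ae_eq_RL_integral nu _ v)//; last first.
    by apply: ae_imply aev => x xv xt; rewrite -xv//; exact: sub_itv xt.
  rewrite RL_integralE ?vE// ?lt0r ?n0//.
  exact: cintegrable_itvSr (itv_ge ts) intv.
- by apply/cvg_complexP.
- by apply/cvg_complexP.
Qed.

End cauchy.
End hilfer.

Theorem lemma2p5 (R : realType) (T alpha beta mu : R) (lambda : R[i])
    (xi0 xi1 : R) (g : R -> R[i])
    (hT : 0 < T)
    (halpha : 1 < alpha <= 2) (hbeta : 1 < beta <= 2) (hmu : 0 <= mu <= 1)
    (hg : {within `[- T, 0], continuous (g : R -> R[i]^o)})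
    (hg' : exists g' : R -> R[i], L1_derivative (- T) 0 g g')
    (u : R -> R[i]) :
  let gamma := beta + mu * (2 - beta) in
  let delta := beta + mu * (alpha - beta) in
  cauchy_solution T alpha beta mu lambda xi0 xi1 g u <->
  {in `]- T, 0[, forall t, u t =
    xi0%:C * ((- t) `^ (gamma - 2))%:C
      * mittag_leffler delta (gamma - 1) (lambda * ((- t) `^ delta)%:C)
    - xi1%:C * ((- t) `^ (gamma - 1))%:C
      * mittag_leffler delta gamma (lambda * ((- t) `^ delta)%:C)
    + cintegral `]t, 0[ (fun z => ((z - t) `^ (delta - 1))%:C
        * mittag_leffler delta delta (lambda * ((z - t) `^ delta)%:C)
        * g z)}.
Proof.
move=> gamma delta; have [g' hg1] := hg'.
have s0 : - T < 0 by rewrite oppr_lt0.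
have /andP[a1 _] := halpha; have /andP[b1 _] := hbeta.
have d1 : 1 < delta by exact: bi_ordinal_gt1.
have c0 : 0 < gamma - 1.
  by rewrite subr_gt0; apply: bi_ordinal_gt1 => //; rewrite ltr1n.
have intg := within_continuous_cintegrable hg.
have solE t : ml_solution delta lambda (gamma - 1) xi0 xi1 g t =
    xi0%:C * ((- t) `^ (gamma - 2))%:C
      * mittag_leffler delta (gamma - 1) (lambda * ((- t) `^ delta)%:C)
    - xi1%:C * ((- t) `^ (gamma - 1))%:C
      * mittag_leffler delta gamma (lambda * ((- t) `^ delta)%:C)
    + cintegral `]t, 0[ (fun z => ((z - t) `^ (delta - 1))%:C
        * mittag_leffler delta delta (lambda * ((z - t) `^ delta)%:C)
        * g z).
  rewrite /ml_solution /ml_kern subrK !mulrA (_ : gamma - 1 - 1 = gamma - 2)//.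
  by ring.
split=> [sol|uE].
  have [intu uE] := cauchy_solution_volterra hT halpha hbeta hmu hg sol.
  move=> t ts; rewrite -solE.
  exact: (volterra_ml_solution s0 (ltW d1) c0 intg intu uE ts).
apply: (volterra_cauchy_solution hT halpha hbeta hmu hg hg1).
apply: (ml_solution_volterra s0 (ltW d1) c0 intg) => t ts.
by rewrite uE// solE.
Qed.
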